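(* Let $G$ be a finite group, $H\le G$ a subgroup and $\omega\colon G^3\to\Bbbk^\times$ a normalized $3$-cocycle. Then the induction functor $I\colon \mathcal{Z}(\mathrm{Vect}_H^{\omega|_H})\to \mathcal{Z}(\mathrm{Vect}_G^\omega)$, with lax structure $(\mu,\eta)$ and oplax structure $(\nu,\epsilon)$ defined in the context, is both a braided lax monoidal functor and a braided oplax monoidal functor, and it preserves the ribbon structure, i.e. $I(\theta_V)=\theta_{I(V)}$ for every object $V$ of $\mathcal{Z}(\mathrm{Vect}_H^{\omega|_H})$.
   Context: $\Bbbk$ is an algebraically closed field of arbitrary characteristic. A normalized $3$-cocycle satisfies $\omega(g_1g_2,g_3,g_4)\omega(g_1,g_2,g_3g_4)=\omega(g_1,g_2,g_3)\omega(g_1,g_2g_3,g_4)\omega(g_2,g_3,g_4)$ and equals $1$ if any entry is the identity. Set $$\tau(h,k)(d)=\frac{\omega(h,k,d)\,\omega(hkd(hk)^{-1},h,k)}{\omega(h,kdk^{-1},k)},\qquad \gamma(h)(d,f)=\frac{\omega(h,d,f)\,\omega(hdh^{-1},hfh^{-1},h)}{\omega(hdh^{-1},h,f)}.$$ The category $\mathcal{Z}(\mathrm{Vect}_G^\omega)$ is described by twisted Yetter--Drinfeld (YD) modules (this is the Drinfeld center of $\mathrm{Vect}_G^\omega$, up to reversing the braiding): objects are finite-dimensional $G$-graded $\Bbbk$-vector spaces $V=\bigoplus_{d}V_d$ with linear maps $v\mapsto g\cdot v$ ($g\in G$) such that $1\cdot v=v$, $h\cdot V_d\subseteq V_{hdh^{-1}}$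 and $h\cdot(k\cdot v_d)=\tau(h,k)(d)\,(hk)\cdot v_d$ for $v_d\in V_d$; morphisms are grading-preserving linear maps commuting with the actions. The tensor product has $(V\otimes W)_d=\bigoplus_{ab=d}V_a\otimes W_b$ and $h\cdot(v_d\otimes w_f)=\gamma(h)(d,f)\,(h\cdot v_d)\otimes(h\cdot w_f)$; the associator is $(v_a\otimes w_b)\otimes u_c\mapsto\omega(a,b,c)^{-1}v_a\otimes(w_b\otimes u_c)$; the unit is $\mathbf 1=\Bbbk$ in degree $1$ with trivial action; the braiding is $c_{V,W}(v_g\otimes w)=g\cdot w\otimes v_g$; the ribbon twist is $\theta_V(v_d)=d\cdot v_d$. The same definitions apply to $H$ with $\omega|_H$. The functor $I$: $I(V)$ is the quotient of $\Bbbk G\otimes V$ by the relations $gh\otimes v_d=\tau(g,h)(d)^{-1}\,g\otimes h\cdot v_d$ ($g\in G$, $h,d\in H$, $v_d\in V_d$), with $g\otimes v_d$ of degree $gdg^{-1}$ and action $k\cdot(g\otimes v_d)=\tau(k,g)(d)\,kg\otimes v_d$; on morphisms $I(f)=\mathrm{id}\otimes f$. Structure maps: - $\nu_{V,W}\colon I(V\otimes W)\to I(V)\otimes I(W)$, $g\otimes(v_d\otimes w_f)\mapsto\gamma(g)(d,f)\,(g\otimes v_d)\otimes(g\otimes w_f)$; $\epsilon\colon I(\mathbf 1)\to\mathbf 1$, $g\otimes1\mapsto1$. - $\mu_{V,W}\colon I(V)\otimes I(W)\to I(V\otimes W)$ is zero on $(g\otimes v)\otimes(k\otimes w)$ if $gH\ne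 kH$, and $(g\otimes v_d)\otimes(g\otimes w_f)\mapsto\gamma(g)(d,f)^{-1}\,g\otimes(v_d\otimes w_f)$ (if $gH=kH$ one uses the relations to rewrite $k\otimes w$ as $g\otimes w'$); $\eta\colon\mathbf 1\to I(\mathbf 1)$, $1\mapsto\sum_i g_i\otimes1$, where $\{g_i\}$ are representatives of the left cosets of $H$ in $G$. A lax monoidal functor $(F,\mu,\eta)$ between braided categories is braided if $\mu_{Y,X}\,c_{F(X),F(Y)}=F(c_{X,Y})\,\mu_{X,Y}$ for all $X,Y$; an oplax monoidal functor $(F,\nu,\epsilon)$ is braided if $c_{F(X),F(Y)}\,\nu_{X,Y}=\nu_{Y,X}\,F(c_{X,Y})$ for all $X,Y$. *)

(* Defs.v *)
(* Everything is written on plain data: a [gmod] is a finite-dimensional space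
   with a family of subspaces (the degrees) and a family of endomorphisms (the
   action), and the objects of Z(Vect_G^omega) are the [gmod]s that satisfy
   [isYD omega].  Tensor products, structure maps and the induction functor are
   defined on all [gmod]s, but are meaningful only on objects: they decompose
   vectors into homogeneous components, and maps out of I(V) are defined on
   generators.  The defining formulas on homogeneous vectors are the lemmas
   below, and [induction_formulas] for the maps out of a quotient. *)
From HB Require Import structures.
From mathcomp Require Import all_boot all_order all_algebra all_fingroup.

Set Implicit Arguments.
Unset Strict Implicit.
Unset Printing Implicit Defensive.

Import GRing.Theory.
Local Open Scope ring_scope.

Section Cocycle.
Variables (k : fieldType) (gT : finGroupType) (omega : gT -> gT -> gT -> k).

Record normalized_cocycle : Prop := NormalizedCocycle {
  cocycle_neq0 : forall a b c, omega a b c != 0;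
  cocycleE : forall a b c d,
    omega (a * b)%g c d * omega a b (c * d)%g =
    omega a b c * omega a (b * c)%g d * omega b c d;
  cocycle1l : forall a b, omega 1%g a b = 1;
  cocycle1m : forall a b, omega a 1%g b = 1;
  cocycle1r : forall a b, omega a b 1%g = 1 }.

Definition tau (h x d : gT) : k :=
  omega h x d * omega (h * x * d * (h * x)^-1)%g h x
  / omega h (x * d * x^-1)%g x.

Definition gamma (h d f : gT) : k :=
  omega h d f * omega (h * d * h^-1)%g (h * f * h^-1)%g h
  / omega (h * d * h^-1)%g h f.

End Cocycle.

Definition res_cocycle (k : fieldType) (gT : finGroupType) (H : {group gT})
    (omega : gT -> gT -> gT -> k) (a b c : subg_of H) : k :=
  omega (sgval a) (sgval b) (sgval c).

(* The tensor product of two spaces is the space of coordinate matrices in the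
   bases [vbasis]; [tlift_pure] is its universal property. *)
Section Tensor.
Variable k : fieldType.

Definition tensor (V W : vectType k) : vectType k :=
  'M[k]_(\dim {:V}, \dim {:W}).

Definition tpure (V W : vectType k) (v : V) (w : W) : tensor V W :=
  \matrix_(i, j) (coord (vbasis {:V}) i v * coord (vbasis {:W}) j w).

Definition tlift (V W U : vectType k) (f : V -> W -> U) : 'Hom(tensor V W, U) :=
  linfun (fun t : 'M[k]_(\dim {:V}, \dim {:W}) =>
    \sum_i \sum_j t i j *: f (vbasis {:V})`_i (vbasis {:W})`_j).

Definition tmap (V V' W W' : vectType k) (f : 'Hom(V, V')) (g : 'Hom(W, W')) :
  'Hom(tensor V W, tensor V' W') := tlift (fun v w => tpure (f v) (g w)).

Definition tspace (V W : vectType k) (A : {vspace V}) (B : {vspace W}) :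
  {vspace tensor V W} :=
  <<[seq tpure v w | v <- vbasis A, w <- vbasis B]>>%VS.

Lemma tliftE (V W U : vectType k) (f : V -> W -> U)
    (t : 'M[k]_(\dim {:V}, \dim {:W})) :
  tlift f t = \sum_i \sum_j t i j *: f (vbasis {:V})`_i (vbasis {:W})`_j.
Proof.
pose g t := \sum_i \sum_j
  (t : 'M[k]_(\dim {:V}, \dim {:W})) i j *:
    f (vbasis {:V})`_i (vbasis {:W})`_j.
have g_lin : linear g.
  move=> a x y; rewrite /g scaler_sumr -big_split; apply: eq_bigr => i _ /=.
  rewrite scaler_sumr -big_split; apply: eq_bigr => j _ /=.
  by rewrite !mxE scalerDl scalerA.
pose G : {linear 'M[k]_(\dim {:V}, \dim {:W}) -> U} :=
  HB.pack g (GRing.isLinear.Build k _ _ _ g g_lin).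
by rewrite /tlift (lfunE G).
Qed.

Lemma tlift_pure (V W U : vectType k) (f : V -> W -> U) (v : V) (w : W) :
  (forall w0, linear (f^~ w0)) -> (forall v0, linear (f v0)) ->
  tlift f (tpure v w) = f v w.
Proof.
move=> fl fr; rewrite tliftE.
pose L w0 : {linear V -> U} :=
  HB.pack (f^~ w0) (GRing.isLinear.Build k _ _ _ (f^~ w0) (fl w0)).
pose R v0 : {linear W -> U} :=
  HB.pack (f v0) (GRing.isLinear.Build k _ _ _ (f v0) (fr v0)).
rewrite {2}(coord_vbasis (memvf v)) -[RHS]/(L w _) linear_sum.
apply: eq_bigr => i _; rewrite linearZ /=.
rewrite {2}(coord_vbasis (memvf w)) -[f _ _]/(R _ _) linear_sum scaler_sumr.
by apply: eq_bigr => j _; rewrite linearZ /= mxE scalerA.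
Qed.

Lemma tpure_linl (V W : vectType k) (w : W) :
  linear (fun v : V => tpure v w : tensor V W).
Proof. by move=> a x y; apply/matrixP=> i j; rewrite !mxE linearP mulrDl mulrA. Qed.

Lemma tpure_linr (V W : vectType k) (v : V) : linear (tpure v : W -> tensor V W).
Proof.
move=> a x y; apply/matrixP=> i j; rewrite !mxE linearP mulrDr.
by rewrite !mulrA [_ * a]mulrC.
Qed.

End Tensor.

Section Quotient.
Variables (k : fieldType) (E : vectType k) (R : {vspace E}).

(* E/R, realised on the complement R^C. *)
Definition vquot : vectType k := subvs_of (R^C)%VS.

Definition vquot_pi : 'Hom(E, vquot) :=
  (linfun (vsproj (R^C)%VS) \o daddv_pi (R^C)%VS R)%VF.

Definition vquot_lift (U : vectType k) (f : 'Hom(E, U)) : 'Hom(vquot, U) :=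
  (f \o linfun (vsval : subvs_of (R^C)%VS -> E))%VF.

Lemma vquot_capC : ((R^C) :&: R = 0)%VS.
Proof. by rewrite capvC capv_compl. Qed.

Lemma vquot_pi_surj (y : vquot) : vquot_pi (vsval y) = y.
Proof.
by rewrite comp_lfunE lfunE /= daddv_pi_id ?vquot_capC ?subvsP // vsvalK.
Qed.

Lemma vquot_pi_ker : lker vquot_pi = R.
Proof.
have piE x : vsval (vquot_pi x) = daddv_pi (R^C)%VS R x.
  by rewrite comp_lfunE lfunE /= vsprojK ?memv_pi.
have decE x : daddv_pi (R^C)%VS R x + daddv_pi R (R^C)%VS x = x.
  by apply: daddv_pi_add; rewrite ?vquot_capC // addvC addv_complf memvf.
apply/vspaceP=> x; rewrite memv_ker; apply/eqP/idP => [x0 | Rx].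
  by rewrite -[x]decE -piE x0 linear0 add0r memv_pi.
apply: subvs_inj; rewrite piE linear0; have /eqP := decE x.
by rewrite (daddv_pi_id (capv_compl R)) // -subr_eq0 addrK => /eqP.
Qed.

Lemma vquot_liftE (U : vectType k) (f : 'Hom(E, U)) x :
  (R <= lker f)%VS -> vquot_lift f (vquot_pi x) = f x.
Proof.
move=> Rf; rewrite comp_lfunE lfunE /=; apply/eqP; rewrite -subr_eq0 -linearB.
rewrite -memv_ker; apply: (subvP Rf).
set z := _ - _; suff: z \in lker vquot_pi by rewrite vquot_pi_ker.
by rewrite memv_ker linearB /= vquot_pi_surj subrr.
Qed.

End Quotient.

(* Data of a G-graded space with linear maps v |-> g . v. *)
Record gmod (k : fieldType) (gT : finGroupType) := GMod {
  gcar :> vectType k;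
  gdeg : gT -> {vspace gcar};
  gact : gT -> 'End(gcar) }.

Section YetterDrinfeld.
Variables (k : fieldType) (gT : finGroupType) (omega : gT -> gT -> gT -> k).
Local Notation gmod := (gmod k gT).

Record isYD (V : gmod) : Prop := IsYD {
  yd_direct : directv (\sum_d gdeg V d);
  yd_full : (\sum_d gdeg V d)%VS = fullv;
  yd_act1 : gact V 1%g = \1%VF;
  yd_act_deg : forall h d,
    (gact V h @: gdeg V d <= gdeg V (h * d * h^-1)%g)%VS;
  yd_actM : forall h x d v, v \in gdeg V d ->
    gact V h (gact V x v) = tau omega h x d *: gact V (h * x)%g v }.

Record isYDmor (V W : gmod) (f : 'Hom(V, W)) : Prop := IsYDMor {
  mor_deg : forall d, (f @: gdeg V d <= gdeg W d)%VS;
  mor_act : forall h, (f \o gact V h = gact W h \o f)%VF }.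

(* The homogeneous component of degree d. *)
Definition gproj (V : gmod) (d : gT) : 'End(V) :=
  daddv_pi (gdeg V d) (\sum_(e | e != d) gdeg V e)%VS.

Definition ydtens (V W : gmod) : gmod :=
  @GMod k gT (tensor V W)
    (fun d => (\sum_(p : gT * gT | (p.1 * p.2)%g == d)
                 tspace (gdeg V p.1) (gdeg W p.2))%VS)
    (fun h => tlift (fun v w => \sum_d \sum_f gamma omega h d f *:
                 tpure (gact V h (gproj V d v)) (gact W h (gproj W f w)))).

Definition ydunit : gmod :=
  @GMod k gT k^o (fun d => if d == 1%g then fullv else 0%VS) (fun=> \1%VF).

Definition ydassoc (V W U : gmod) :
  'Hom(ydtens (ydtens V W) U, ydtens V (ydtens W U)) :=
  tlift (fun t u => tlift (fun v w => \sum_a \sum_b \sum_c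
    (omega a b c)^-1 *: (tpure (gproj V a v)
       (tpure (gproj W b w) (gproj U c u) : tensor W U) : tensor V (tensor W U)))
    t).

Definition ydlunit (V : gmod) : 'Hom(ydtens ydunit V, V) :=
  tlift (fun (a : k^o) v => a *: v).

Definition ydrunit (V : gmod) : 'Hom(ydtens V ydunit, V) :=
  tlift (fun v (a : k^o) => a *: v).

Definition ydbraid (V W : gmod) : 'Hom(ydtens V W, ydtens W V) :=
  tlift (fun v w => \sum_g tpure (gact W g w) (gproj V g v)).

Definition ydtwist (V : gmod) : 'End(V) :=
  \sum_d (gact V d \o gproj V d)%VF.

Definition ydtmap (V V' W W' : gmod) (f : 'Hom(V, V')) (g : 'Hom(W, W')) :
  'Hom(ydtens V W, ydtens V' W') := tmap f g.

Section Formulas.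
Variables (V W U : gmod) (a b c : gT) (v : V) (w : W) (u : U).
Hypotheses (ydV : isYD V) (ydW : isYD W) (ydU : isYD U).
Hypotheses (Va : v \in gdeg V a) (Wb : w \in gdeg W b) (Uc : u \in gdeg U c).

Lemma gproj_hom (X : gmod) d e x :
  isYD X -> x \in gdeg X d -> gproj X e x = if e == d then x else 0.
Proof.
move=> ydX Xd.
have /directv_sumP dX := yd_direct ydX.
have cap0 : (gdeg X e :&: \sum_(i | i != e) gdeg X i = 0)%VS by exact: dX.
case: eqP => [->|/eqP ned]; first by rewrite /gproj daddv_pi_id //; apply: dX.
have xS : x \in (\sum_(i | i != e) gdeg X i)%VS.
  by apply: (subvP (sumv_sup d _ (subvv _))); rewrite ?(eq_sym d).
have /eqP := daddv_pi_add cap0 (subvP (addvSr _ _) _ xS).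
rewrite (daddv_pi_id _ xS) 1?capvC // /gproj.
by rewrite -subr_eq0 addrK => /eqP.
Qed.

Lemma ydtens_actE h : gact (ydtens V W) h (tpure v w) =
  gamma omega h a b *: tpure (gact V h v) (gact W h w).
Proof.
have t0r (X Y : vectType k) (x : X) : tpure x (0 : Y) = 0.
  by apply/matrixP=> i j; rewrite !mxE linear0 mulr0.
have t0l (X Y : vectType k) (y : Y) : tpure (0 : X) y = 0.
  by apply/matrixP=> i j; rewrite !mxE linear0 mul0r.
rewrite tlift_pure; first last.
- move=> v0 r x y; rewrite scaler_sumr -big_split; apply: eq_bigr => d _ /=.
  rewrite scaler_sumr -big_split; apply: eq_bigr => f _ /=.
  by rewrite !linearP /= tpure_linr scalerDr !scalerA [r * _]mulrC.
- move=> w0 r x y; rewrite scaler_sumr -big_split; apply: eq_bigr => d _ /=.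
  rewrite scaler_sumr -big_split; apply: eq_bigr => f _ /=.
  by rewrite !linearP /= tpure_linl scalerDr !scalerA [r * _]mulrC.
rewrite (bigD1 a) //= (bigD1 b) //= !(gproj_hom _ ydV Va) !(gproj_hom _ ydW Wb).
rewrite !eqxx !big1 ?addr0 // => [d /negPf nd | f /negPf nf].
  by apply: big1 => f _; rewrite (gproj_hom _ ydV Va) nd linear0 t0l scaler0.
by rewrite (gproj_hom _ ydW Wb) nf linear0 t0r scaler0.
Qed.

Lemma ydassocE : ydassoc V W U (tpure (tpure v w : tensor V W) u) =
  (omega a b c)^-1 *: (tpure v (tpure w u : tensor W U) : tensor V (tensor W U)).
Proof.
pose T x y z : tensor V (tensor W U) := tpure x (tpure y z : tensor W U).
have T0 x y z : [|| x == 0, y == 0 | z == 0] -> T x y z = 0.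
  case/or3P=> /eqP->; apply/matrixP=> i j; rewrite !mxE ?linear0 ?mul0r //.
    rewrite (_ : tpure 0 z = 0) ?linear0 ?mulr0 //.
    by apply/matrixP=> i' j'; rewrite !mxE linear0 mul0r.
  rewrite (_ : tpure y 0 = 0) ?linear0 ?mulr0 //.
  by apply/matrixP=> i' j'; rewrite !mxE linear0 mulr0.
pose S x y z := \sum_d \sum_e \sum_f (omega d e f)^-1 *:
  T (gproj V d x) (gproj W e y) (gproj U f z).
have linS (A : vectType k) (F : gT -> gT -> gT -> A -> tensor V (tensor W U)) :
    (forall d e f, linear (F d e f)) ->
    linear (fun x => \sum_d \sum_e \sum_f (omega d e f)^-1 *: F d e f x).
  move=> Fl r x y; rewrite scaler_sumr -big_split; apply: eq_bigr => d _ /=.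
  rewrite scaler_sumr -big_split; apply: eq_bigr => e _ /=.
  rewrite scaler_sumr -big_split; apply: eq_bigr => f _ /=.
  by rewrite Fl scalerDr !scalerA [r * _]mulrC.
have S1 y z : linear (fun x => S x y z).
  by apply: linS => d e f r x x'; rewrite linearP /= /T tpure_linl.
have S2 x z : linear (fun y => S x y z).
  apply: linS => d e f r y y'.
  by rewrite linearP /= /T tpure_linl tpure_linr.
have S3 x y : linear (fun z => S x y z).
  apply: linS => d e f r z z'.
  by rewrite linearP /= /T tpure_linr tpure_linr.
have -> : ydassoc V W U (tpure (tpure v w : tensor V W) u) = S v w u.
  rewrite tlift_pure; last 2 first.
  - by move=> u0 r t t'; rewrite linearP.
  - move=> t r u1 u2; rewrite !tliftE scaler_sumr -big_split.
    apply: eq_bigr => i _ /=; rewrite scaler_sumr -big_split.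
    apply: eq_bigr => j _ /=.
    by rewrite -!/(S _ _ _) S3 scalerDr !scalerA [r * _]mulrC.
  by rewrite tlift_pure // => [y|x]; [exact: S1 | exact: S2].
rewrite /S (bigD1 a) //= (bigD1 b) //= (bigD1 c) //=.
rewrite !(gproj_hom _ ydV Va) !(gproj_hom _ ydW Wb) !(gproj_hom _ ydU Uc) !eqxx.
rewrite !big1 ?addr0 // => [d /negPf nd | e /negPf ne | f /negPf nf].
- apply: big1 => e _; apply: big1 => f _.
  by rewrite (gproj_hom _ ydV Va) nd T0 ?eqxx ?scaler0.
- apply: big1 => f _.
  by rewrite (gproj_hom _ ydW Wb) ne T0 ?eqxx ?orbT ?scaler0.
- by rewrite (gproj_hom _ ydU Uc) nf T0 ?eqxx ?orbT ?scaler0.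
Qed.

Lemma ydbraidE : ydbraid V W (tpure v w) = tpure (gact W a w) v.
Proof.
have t0r (X Y : vectType k) (x : X) : tpure x (0 : Y) = 0.
  by apply/matrixP=> i j; rewrite !mxE linear0 mulr0.
rewrite tlift_pure; first last.
- move=> v0 r x y; rewrite scaler_sumr -big_split; apply: eq_bigr => d _ /=.
  by rewrite linearP /= tpure_linl.
- move=> w0 r x y; rewrite scaler_sumr -big_split; apply: eq_bigr => d _ /=.
  by rewrite linearP /= tpure_linr.
rewrite (bigD1 a) //= (gproj_hom _ ydV Va) eqxx big1 ?addr0 // => d /negPf nd.
by rewrite (gproj_hom _ ydV Va) nd t0r.
Qed.

Lemma ydtwistE : ydtwist V v = gact V a v.
Proof.
rewrite sum_lfunE (bigD1 a) //= comp_lfunE (gproj_hom _ ydV Va) eqxx big1 ?addr0 //.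
by move=> d /negPf nd; rewrite comp_lfunE (gproj_hom _ ydV Va) nd linear0.
Qed.

End Formulas.
End YetterDrinfeld.

(* Functors between two categories of twisted Yetter-Drinfeld modules. *)
Record prefunctor (k : fieldType) (hT gT : finGroupType) := PreFunctor {
  fob :> gmod k hT -> gmod k gT;
  fmap : forall V W : gmod k hT, 'Hom(V, W) -> 'Hom(fob V, fob W) }.

Arguments fmap {k hT gT} p {V W}.

Section Functors.
Variables (k : fieldType) (hT gT : finGroupType).
Variables (omH : hT -> hT -> hT -> k) (omG : gT -> gT -> gT -> k).
Variable F : prefunctor k hT gT.

Local Notation "V '*H' W" := (ydtens omH V W) (at level 40).
Local Notation "V '*G' W" := (ydtens omG V W) (at level 40).
Local Notation "f '*h' g" := (ydtmap omH f g) (at level 40).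
Local Notation "f '*g' g" := (ydtmap omG f g) (at level 40).
Local Notation unitH := (ydunit k hT).
Local Notation unitG := (ydunit k gT).
Local Notation "1_( V )" := (\1%VF : 'End(gcar V)).

Record is_functor : Prop := IsFunctor {
  functor_ob : forall V : gmod k hT, isYD omH V -> isYD omG (F V);
  functor_mor : forall (V W : gmod k hT) (f : 'Hom(V, W)), isYD omH V -> isYD omH W ->
    isYDmor f -> isYDmor (fmap F f);
  functor_id : forall V : gmod k hT, isYD omH V -> fmap F 1_(V) = 1_(F V);
  functor_comp : forall (U V W : gmod k hT) (g : 'Hom(V, W)) (f : 'Hom(U, V)),
    isYD omH U -> isYD omH V -> isYD omH W -> isYDmor g -> isYDmor f ->
    fmap F (g \o f)%VF = (fmap F g \o fmap F f)%VF }.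

Section Lax.
Variables (mu : forall V W : gmod k hT, 'Hom(F V *G F W, F (V *H W)))
          (eta : 'Hom(unitG, F unitH)).

Record is_lax_monoidal : Prop := IsLaxMonoidal {
  lax_functor : is_functor;
  lax_mu_mor : forall V W : gmod k hT, isYD omH V -> isYD omH W -> isYDmor (mu V W);
  lax_eta_mor : isYDmor eta;
  lax_natural : forall (V V' W W' : gmod k hT) (f : 'Hom(V, V')) (g : 'Hom(W, W')),
    isYD omH V -> isYD omH V' -> isYD omH W -> isYD omH W' ->
    isYDmor f -> isYDmor g ->
    (mu V' W' \o (fmap F f *g fmap F g) = fmap F (f *h g) \o mu V W)%VF;
  lax_assoc : forall X Y Z : gmod k hT, isYD omH X -> isYD omH Y -> isYD omH Z ->
    (fmap F (ydassoc omH X Y Z) \o mu (X *H Y) Z \o (mu X Y *g 1_(F Z)))%VF =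
    (mu X (Y *H Z) \o (1_(F X) *g mu Y Z) \o ydassoc omG (F X) (F Y) (F Z))%VF;
  lax_unitl : forall X : gmod k hT, isYD omH X ->
    (fmap F (ydlunit omH X) \o mu unitH X \o (eta *g 1_(F X)))%VF =
    ydlunit omG (F X);
  lax_unitr : forall X : gmod k hT, isYD omH X ->
    (fmap F (ydrunit omH X) \o mu X unitH \o (1_(F X) *g eta))%VF =
    ydrunit omG (F X) }.

Record is_braided_lax_monoidal : Prop := IsBraidedLaxMonoidal {
  braided_lax_monoidal : is_lax_monoidal;
  lax_braided : forall X Y : gmod k hT, isYD omH X -> isYD omH Y ->
    (mu Y X \o ydbraid omG (F X) (F Y) = fmap F (ydbraid omH X Y) \o mu X Y)%VF }.

End Lax.

Section Oplax.
Variables (nu : forall V W : gmod k hT, 'Hom(F (V *H W), F V *G F W))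
          (eps : 'Hom(F unitH, unitG)).

Record is_oplax_monoidal : Prop := IsOplaxMonoidal {
  oplax_functor : is_functor;
  oplax_nu_mor : forall V W : gmod k hT, isYD omH V -> isYD omH W -> isYDmor (nu V W);
  oplax_eps_mor : isYDmor eps;
  oplax_natural : forall (V V' W W' : gmod k hT) (f : 'Hom(V, V')) (g : 'Hom(W, W')),
    isYD omH V -> isYD omH V' -> isYD omH W -> isYD omH W' ->
    isYDmor f -> isYDmor g ->
    ((fmap F f *g fmap F g) \o nu V W = nu V' W' \o fmap F (f *h g))%VF;
  oplax_assoc : forall X Y Z : gmod k hT, isYD omH X -> isYD omH Y -> isYD omH Z ->
    (ydassoc omG (F X) (F Y) (F Z) \o (nu X Y *g 1_(F Z)) \o nu (X *H Y) Z)%VF =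
    ((1_(F X) *g nu Y Z) \o nu X (Y *H Z) \o fmap F (ydassoc omH X Y Z))%VF;
  oplax_unitl : forall X : gmod k hT, isYD omH X ->
    (ydlunit omG (F X) \o (eps *g 1_(F X)) \o nu unitH X)%VF =
    fmap F (ydlunit omH X);
  oplax_unitr : forall X : gmod k hT, isYD omH X ->
    (ydrunit omG (F X) \o (1_(F X) *g eps) \o nu X unitH)%VF =
    fmap F (ydrunit omH X) }.

Record is_braided_oplax_monoidal : Prop := IsBraidedOplaxMonoidal {
  braided_oplax_monoidal : is_oplax_monoidal;
  oplax_braided : forall X Y : gmod k hT, isYD omH X -> isYD omH Y ->
    (ydbraid omG (F X) (F Y) \o nu X Y = nu Y X \o fmap F (ydbraid omH X Y))%VF }.

End Oplax.

Definition preserves_ribbon : Prop := forall V : gmod k hT, isYD omH V ->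
  fmap F (ydtwist V) = ydtwist (F V).

End Functors.

Section Induction.
Variables (k : fieldType) (gT : finGroupType) (H : {group gT}).
Variable omega : gT -> gT -> gT -> k.
Local Notation hT := (subg_of H).
Local Notation omH := (res_cocycle (H := H) omega).

(* kG (x) V is the space of functions G -> V; [gtens g v] is g (x) v. *)
Definition gtens (V : vectType k) (g : gT) (v : V) : {ffun gT -> V} :=
  [ffun x => if x == g then v else 0].

Definition ind_rel (V : gmod k hT) : {vspace {ffun gT -> V}} :=
  (\sum_(g : gT) \sum_(h : hT) \sum_(d : hT)
     linfun (fun v : V => gtens (g * sgval h)%g v -
               (tau omega g (sgval h) (sgval d))^-1 *: gtens g (gact V h v))
     @: gdeg V d)%VS.

Definition ind_car (V : gmod k hT) : vectType k := vquot (ind_rel V).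

(* The class of g (x) v in I(V). *)
Definition icl (V : gmod k hT) (g : gT) (v : V) : ind_car V :=
  vquot_pi (ind_rel V) (gtens g v).

(* The linear map I(V) -> U with g (x) v |-> f g v, for f linear in v and
   compatible with the relations. *)
Definition ind_lift (V : gmod k hT) (U : vectType k) (f : gT -> V -> U) :
  'Hom(ind_car V, U) :=
  vquot_lift (ind_rel V)
    (linfun (fun phi : {ffun gT -> V} => \sum_g f g (phi g))).

Definition ind_ob (V : gmod k hT) : gmod k gT :=
  @GMod k gT (ind_car V)
    (fun x => (\sum_(g : gT) \sum_(d : hT | (g * sgval d * g^-1)%g == x)
                 linfun (icl (V := V) g) @: gdeg V d)%VS)
    (fun x => ind_lift (fun g v => \sum_(d : hT)
                 tau omega x g (sgval d) *: icl (x * g)%g (gproj V d v))).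

Definition ind_map (V W : gmod k hT) (f : 'Hom(V, W)) :
  'Hom(ind_ob V, ind_ob W) := ind_lift (fun g v => icl g (f v)).

Definition ind : prefunctor k hT gT := PreFunctor ind_map.

Definition ind_nu (V W : gmod k hT) :
  'Hom(ind (ydtens omH V W), ydtens omega (ind V) (ind W)) :=
  ind_lift (V := ydtens omH V W) (fun g t =>
    tlift (fun v w => \sum_(d : hT) \sum_(f : hT)
      gamma omega g (sgval d) (sgval f) *:
        (tpure (icl g (gproj V d v)) (icl g (gproj W f w)) :
           tensor (ind_car V) (ind_car W))) t).

Definition ind_eps : 'Hom(ind (ydunit k hT), ydunit k gT) :=
  ind_lift (V := ydunit k hT) (fun _ (a : k^o) => a : k^o).

(* For gH = xH and h = g^-1 x in H, the vector x (x) w_f is rewritten as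
   tau(g,h)(f)^-1 g (x) h . w_f, and h . w_f has degree h f h^-1. *)
Definition ind_mu (V W : gmod k hT) :
  'Hom(ydtens omega (ind V) (ind W), ind (ydtens omH V W)) :=
  tlift (fun p q => ind_lift (fun g v => ind_lift (fun x w =>
    if (g *: H == x *: H)%g then
      let h : hT := subg H (g^-1 * x)%g in
      \sum_(d : hT) \sum_(f : hT)
        ((tau omega g (sgval h) (sgval f))^-1 *
         (gamma omega g (sgval d) (sgval (h * f * h^-1)%g))^-1) *:
        icl (V := ydtens omH V W) g
          (tpure (gproj V d v) (gact W h (gproj W f w)))
    else 0) q) p).

(* The sum over coset representatives, for the representatives [repr C]. *)
Definition ind_eta : 'Hom(ydunit k gT, ind (ydunit k hT)) :=
  linfun (fun a : k^o => \sum_(C in lcosets H [set: gT])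
    icl (V := ydunit k hT) (repr C) a).

(* The maps above are well defined: they satisfy their defining formulas. *)
Record induction_formulas : Prop := InductionFormulas {
  ind_actE : forall V : gmod k hT, isYD omH V -> forall x g d (v : V), v \in gdeg V d ->
    gact (ind V) x (icl g v) = tau omega x g (sgval d) *: icl (x * g)%g v;
  ind_mapE : forall (V W : gmod k hT) (f : 'Hom(V, W)), isYD omH V -> isYD omH W ->
    isYDmor f -> forall g v, fmap ind f (icl g v) = icl g (f v);
  ind_nuE : forall V W : gmod k hT, isYD omH V -> isYD omH W ->
    forall g d f (v : V) (w : W), v \in gdeg V d -> w \in gdeg W f ->
    ind_nu V W (icl (V := ydtens omH V W) g (tpure v w)) =
    gamma omega g (sgval d) (sgval f) *: tpure (icl g v) (icl g w);
  ind_epsE : forall g, ind_eps (icl (V := ydunit k hT) g (1 : k^o)) = (1 : k^o);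
  ind_mu_eq0 : forall V W : gmod k hT, isYD omH V -> isYD omH W ->
    forall g x (v : V) (w : W), (g *: H != x *: H)%g ->
    ind_mu V W (tpure (icl g v) (icl x w)) = 0;
  ind_muE : forall V W : gmod k hT, isYD omH V -> isYD omH W ->
    forall g d f (v : V) (w : W), v \in gdeg V d -> w \in gdeg W f ->
    ind_mu V W (tpure (icl g v) (icl g w)) =
    (gamma omega g (sgval d) (sgval f))^-1 *:
      icl (V := ydtens omH V W) g (tpure v w);
  ind_etaE : forall X : {set gT},
    is_transversal X (lcosets H [set: gT]) [set: gT] ->
    ind_eta (1 : k^o) = \sum_(g in X) icl (V := ydunit k hT) g (1 : k^o) }.

Lemma gtens_lin (V : vectType k) g : linear (gtens g : V -> {ffun gT -> V}).
Proof.
move=> a x y; apply/ffunP=> z; rewrite !ffunE.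
by case: eqP; rewrite ?scaler0 ?addr0.
Qed.

Lemma icl_relation (V : gmod k hT) g (h d : hT) (v : V) : v \in gdeg V d ->
  icl (g * sgval h)%g v =
  (tau omega g (sgval h) (sgval d))^-1 *: icl g (gact V h v).
Proof.
move=> Vd; set c := (tau _ _ _ _)^-1.
apply/eqP; rewrite -subr_eq0 -linearZ -linearB -memv_ker vquot_pi_ker /=.
pose r (v : V) := gtens (g * sgval h)%g v - c *: gtens g (gact V h v).
have r_lin : linear r.
  move=> a x y; rewrite /r linearP !gtens_lin scalerDr scalerBr !scalerA.
  by rewrite [c * a]mulrC opprD addrACA.
pose rL : {linear V -> {ffun gT -> V}} :=
  HB.pack r (GRing.isLinear.Build k _ _ _ r r_lin).
apply: (subvP (sumv_sup g _ (sumv_sup h _ (sumv_sup d _ (subvv _))))) => //.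
by apply/memv_imgP; exists v; rewrite // -/c (lfunE rL).
Qed.

End Induction.

Arguments res_cocycle {k gT} H omega a b c.
Arguments is_braided_lax_monoidal {k hT gT} omH omG F mu eta.
Arguments is_braided_oplax_monoidal {k hT gT} omH omG F nu eps.
Arguments preserves_ribbon {k hT gT} omH F.
Arguments ind {k gT} H omega.
Arguments ind_mu {k gT} H omega V W.
Arguments ind_nu {k gT} H omega V W.
Arguments ind_eta {k gT} H omega.
Arguments ind_eps {k gT} H omega.
Arguments induction_formulas {k gT} H omega.

(* Main.v *)
(* Every identity of maps is checked on generators: I(V) is spanned by the
   classes g (x) v with v homogeneous, and a pair of generators of I(V) and
   I(W) either lies over distinct cosets, where mu vanishes, or can be
   rewritten over a single representative g.  What remains are scalar
   identities.  The multiplicativity of tau and the compatibilities of gamma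
   with tau and with omega are alternating products of the cocycle condition
   over the shuffles of the acting letters with the degrees; the braiding and
   twist identities cancel term by term. *)
From HB Require Import structures.
From mathcomp Require Import all_boot all_order all_algebra all_fingroup.
From mathcomp Require Import ring.
(* Imported last: [all_fingroup] has another [gact]. *)
Require Import Defs.

Set Implicit Arguments.
Unset Strict Implicit.
Unset Printing Implicit Defensive.

Import GRing.Theory.
Local Open Scope ring_scope.

(** * Identities between [tau], [gamma] and [omega] *)

(** The class g (x) v in I(V) behaves like a vector g . v would if G acted on V. So each scalar
    identity is used twice: with acting letters only, it gives the tensor category; with the
    generator g among the letters, it gives induction. [tau_cocycle] on (x, g, h) makes the action
    of x on I(V) respect the relations, and on (x, y, g) makes it multiplicative up to [tau].
    [gamma_tau] on (g, h) makes nu and mu well defined, and on (x, g) makes them equivariant.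
    [gamma_assoc] gives the associativity of both, [gamma_tau_braid] both braiding axioms,
    [tau_twist] the twist. The obstacle is the quotient. There is no explicit basis of I(V), so
    spanning is phrased through subspaces, and the grading is obtained from projections that descend
    to the quotient. The map mu starts from two quotients at once and is written over the left
    representative. A change of the right representative is absorbed by [tau_cocycle] alone; a
    change of the left one also moves the result inside I(V (x) W), and there [gamma_tau] is needed
    as well. *)

(** The equation P = Q is taken to be a product of instances of known identities, chosen so that x *
    P = y * Q holds formally. Then [field] can verify the latter with the values of [omega], [tau]
    and [gamma] as independent symbols. *)
Lemma mul_ratio_inj (k : fieldType) (P Q x y : k) :
  P != 0 -> P = Q -> x * P = y * Q -> x = y.
Proof. by move=> P0 <- /(mulIf P0). Qed.

Section CocycleIdentities.
Variables (k : fieldType) (gT : finGroupType) (omega : gT -> gT -> gT -> k).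
Hypothesis omega_cocycle : normalized_cocycle omega.
Implicit Types a b c d e f g h x z : gT.

Let w0 a b c : omega a b c != 0 := cocycle_neq0 omega_cocycle a b c.
Let wE := cocycleE omega_cocycle.
Let w1 := (cocycle1l omega_cocycle, cocycle1m omega_cocycle,
           cocycle1r omega_cocycle).

(** Conjugates enter through commutation equations, so that they can be turned into opaque letters.
    Rewriting x * d as d1 * x then makes the arguments of [omega] agree across different instances
    of the cocycle condition. *)
Local Lemma tau_commE h x d d1 d2 :
  (x * d = d1 * x)%g -> (h * d1 = d2 * h)%g ->
  tau omega h x d = omega h x d * omega d2 h x / omega h d1 x.
Proof.
move=> E1 E2; have e1 : (x * d * x^-1 = d1)%g by rewrite E1 mulgK.
have e2 : (h * x * d * (h * x)^-1 = d2)%g.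
  by rewrite -(mulgA h) E1 mulgA E2 invMg !mulgA !mulgK.
by rewrite /tau e1 e2.
Qed.

Local Lemma gamma_commE h d f d1 f1 :
  (h * d = d1 * h)%g -> (h * f = f1 * h)%g ->
  gamma omega h d f = omega h d f * omega d1 f1 h / omega d1 h f.
Proof. by move=> E1 E2; rewrite /gamma E1 E2 !mulgK. Qed.

Local Lemma conj_comm h d : (h * d = (h * d * h^-1) * h)%g.
Proof. by rewrite mulgKV. Qed.

Lemma tau_neq0 h x d : tau omega h x d != 0.
Proof. by rewrite /tau !mulf_neq0 ?invr_neq0 ?w0. Qed.

Lemma gamma_neq0 h d f : gamma omega h d f != 0.
Proof. by rewrite /gamma !mulf_neq0 ?invr_neq0 ?w0. Qed.

Lemma tau_1l x d : tau omega 1%g x d = 1.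
Proof. by rewrite /tau !w1 divr1 mulr1. Qed.

Lemma tau_1m h d : tau omega h 1%g d = 1.
Proof. by rewrite /tau !w1 divr1 mulr1. Qed.

Lemma tau_1r h x : tau omega h x 1%g = 1.
Proof. by rewrite /tau !mulg1 !mulgV !w1 divr1 mulr1. Qed.

Lemma gamma_1l d f : gamma omega 1%g d f = 1.
Proof. by rewrite /gamma !w1 divr1 mulr1. Qed.

Lemma gamma_1m h f : gamma omega h 1%g f = 1.
Proof. by rewrite /gamma !mulg1 !mulgV !w1 divr1 mulr1. Qed.

Lemma gamma_1r h d : gamma omega h d 1%g = 1.
Proof. by rewrite /gamma !mulg1 !mulgV !w1 divr1 mulr1. Qed.

(** The two ways of contracting h . (x . (z . v)) with v of degree d differ by these scalars. *)
Lemma tau_cocycle h x z d :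
  tau omega h x (z * d * z^-1)%g * tau omega (h * x)%g z d =
  tau omega h (x * z)%g d * tau omega x z d.
Proof.
set d1 := (z * d * z^-1)%g; have e1 : (z * d = d1 * z)%g by exact: conj_comm.
have e2 := conj_comm x d1; set d2 := (x * d1 * x^-1)%g in e2.
have e3 := conj_comm h d2; set d3 := (h * d2 * h^-1)%g in e3.
clearbody d3 d2 d1.
rewrite (tau_commE e2 e3) (tau_commE e1 e2).
rewrite (@tau_commE (h * x) z d d1 d3) //; last first.
  by rewrite -mulgA e2 !mulgA e3.
rewrite (@tau_commE h (x * z) d d2 d3) //; last first.
  by rewrite -mulgA e1 !mulgA e2.
(* The degree, conjugated by each letter that it passes, stands at one of four places. The sides are
   exchanged below when it has passed an even number of letters. *)
have E1 := wE h x z d; have E2 := wE d3 h x z.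
have E3 := wE h x d1 z; have E4 := wE h d2 x z.
rewrite -e1 e2 in E3; rewrite -e3 in E2.
apply: (mul_ratio_inj _ (congr2 *%R (congr2 *%R (esym E1) E2)
  (congr2 *%R E3 (esym E4)))); rewrite ?mulf_neq0 ?w0 //.
by field; rewrite !w0.
Qed.

(** The scalars in the comparison of h . (x . (v (x) w)) with (h x) . (v (x) w), for v and w of
    degrees d and f. *)
Lemma gamma_tau h x d f :
  gamma omega h (x * d * x^-1)%g (x * f * x^-1)%g * gamma omega x d f *
    (tau omega h x d * tau omega h x f) =
  tau omega h x (d * f)%g * gamma omega (h * x)%g d f.
Proof.
set d1 := (x * d * x^-1)%g; set f1 := (x * f * x^-1)%g.
have ed1 : (x * d = d1 * x)%g by exact: conj_comm.
have ef1 : (x * f = f1 * x)%g by exact: conj_comm.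
have ed2 := conj_comm h d1; set d2 := (h * d1 * h^-1)%g in ed2.
have ef2 := conj_comm h f1; set f2 := (h * f1 * h^-1)%g in ef2.
clearbody d2 f2 d1 f1.
rewrite (gamma_commE ed2 ef2) (gamma_commE ed1 ef1).
rewrite (tau_commE ed1 ed2) (tau_commE ef1 ef2).
rewrite (@tau_commE h x (d * f)%g (d1 * f1)%g (d2 * f2)%g); first last.
- by rewrite mulgA ed2 -!mulgA ef2.
- by rewrite mulgA ed1 -!mulgA ef1.
rewrite (@gamma_commE (h * x)%g d f d2 f2); first last.
- by rewrite -mulgA ef1 !mulgA ef2.
- by rewrite -mulgA ed1 !mulgA ed2.
(* The six shuffles of h, x with d, f. Those with an odd number of crossings, [E2] and [E5], enter
   with their sides exchanged. *)
have E1 := wE h x d f; have E2 := wE h d1 x f; have E3 := wE h d1 f1 x.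
have E4 := wE d2 h x f; have E5 := wE d2 h f1 x; have E6 := wE d2 f2 h x.
rewrite -?ed1 -?ef1 -?ed2 -?ef2 in E1 E2 E3 E4 E5 E6.
apply: (mul_ratio_inj _ (congr2 *%R (congr2 *%R (congr2 *%R E1 (esym E2))
  (congr2 *%R E3 E4)) (congr2 *%R (esym E5) E6))); rewrite ?mulf_neq0 ?w0 //.
by field; rewrite !w0.
Qed.

Lemma gamma_assoc h a b c :
  gamma omega h a b * gamma omega h (a * b)%g c * omega a b c =
  omega (h * a * h^-1)%g (h * b * h^-1)%g (h * c * h^-1)%g *
    (gamma omega h a (b * c)%g * gamma omega h b c).
Proof.
have ea := conj_comm h a; set a' := (h * a * h^-1)%g in ea *.
have eb := conj_comm h b; set b' := (h * b * h^-1)%g in eb *.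
have ec := conj_comm h c; set c' := (h * c * h^-1)%g in ec *.
clearbody a' b' c'.
rewrite (gamma_commE ea eb) (gamma_commE eb ec).
rewrite (@gamma_commE h (a * b)%g c (a' * b')%g c') //; last first.
  by rewrite mulgA ea -!mulgA eb.
rewrite (@gamma_commE h a (b * c)%g a' (b' * c')%g) //; last first.
  by rewrite mulgA eb -!mulgA ec.
have E1 := wE h a b c; have E2 := wE a' h b c.
have E3 := wE a' b' h c; have E4 := wE a' b' c' h.
rewrite ea in E1; rewrite eb in E2; rewrite ec in E3.
apply: (mul_ratio_inj _ (congr2 *%R (congr2 *%R E1 (esym E2))
  (congr2 *%R E3 (esym E4)))); rewrite ?mulf_neq0 ?w0 //.
by field; rewrite !w0.
Qed.

(** Equivariance under h of the braiding v (x) w -> g . w (x) v, for v of degree g and w of degree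
    f, read off on scalars. *)
Lemma gamma_tau_braid h g f :
  gamma omega h (g * f * g^-1)%g g * tau omega h g f =
  gamma omega h g f * tau omega (h * g * h^-1)%g h f.
Proof.
rewrite /gamma /tau !mulgKV invMg !mulgA.
by field; rewrite !w0.
Qed.

(** Equivariance of the twist: the left scalar comes from (h d h^-1) . (h . v), the right one from h
    . (d . v). *)
Lemma tau_twist h d : tau omega (h * d * h^-1)%g h d = tau omega h d d.
Proof.
rewrite /tau !mulgKV !mulgK invMg !mulgA mulgK.
by field; rewrite !w0.
Qed.

End CocycleIdentities.

(** * Tensors and spanning sets *)

Section LinearAlgebra.
Variable k : fieldType.
Implicit Types U V W : vectType k.

Lemma linear_sumf V U (I : finType) (P : pred I) (F : I -> V -> U) :
  (forall i, linear (F i)) -> linear (fun v => \sum_(i | P i) F i v).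
Proof.
move=> Fl a x y; rewrite scaler_sumr -big_split.
by apply: eq_bigr => i _; rewrite Fl.
Qed.

Lemma linear_scalef V U c (F : V -> U) : linear F -> linear (fun v => c *: F v).
Proof. by move=> Fl a x y; rewrite Fl scalerDr !scalerA [c * a]mulrC. Qed.

Lemma linear_subf V U (f g : V -> U) :
  linear f -> linear g -> linear (fun v => f v - g v).
Proof. by move=> fl gl a x y; rewrite fl gl scalerBr addrACA -opprD. Qed.

Lemma linfunE V U (f : V -> U) v : linear f -> linfun f v = f v.
Proof.
move=> fl; pose F : {linear V -> U} :=
  HB.pack f (GRing.isLinear.Build k _ _ _ f fl).
exact: (lfunE F v).
Qed.

Lemma linear_at0 V U (f : V -> U) : linear f -> f 0 = 0.
Proof. by move=> fl; rewrite -(linfunE 0 fl) linear0. Qed.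

Lemma memv_lker_sub V U (f g : 'Hom(V, U)) v :
  (v \in lker (f - g)) = (f v == g v).
Proof. by rewrite memv_ker add_lfunE opp_lfunE subr_eq0. Qed.

Lemma lfun0 V U (f : 'Hom(V, U)) : f 0 = 0.
Proof. exact: linear0. Qed.

Lemma lfunZ V U (f : 'Hom(V, U)) a v : f (a *: v) = a *: f v.
Proof. exact: linearZ. Qed.

Lemma lfun_sum V U (f : 'Hom(V, U)) (I : finType) (P : pred I) (F : I -> V) :
  f (\sum_(i | P i) F i) = \sum_(i | P i) f (F i).
Proof. exact: linear_sum. Qed.

Lemma comp_lfun3E V V' W U (f : 'Hom(V, V')) (g : 'Hom(V', W)) (h : 'Hom(W, U)) v :
  (h \o g \o f)%VF v = h (g (f v)).
Proof. by rewrite !comp_lfunE. Qed.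

Lemma limg_sub_preim V U (f : 'Hom(V, U)) (A : {vspace V}) (B : {vspace U}) :
  (f @: A <= B)%VS = (A <= f @^-1: B)%VS.
Proof.
apply/subvP/subvP => [fAB v Av | AfB _ /memv_imgP[v Av ->]].
  by rewrite -memv_preim fAB ?memv_img.
by rewrite memv_preim AfB.
Qed.

(** If v in [D i] also lies in the sum of the other pieces, then [p i] both fixes and kills it. This
    yields gradings on tensor products and on quotients without choosing bases. *)
Lemma directv_projections V (I : finType) (D : I -> {vspace V})
    (p : I -> 'End(V)) :
    (forall i, {in D i, forall v, p i v = v}) ->
    (forall i j, i != j -> {in D i, forall v, p j v = 0}) ->
  directv (\sum_i D i).
Proof.
move=> p_id p_0; apply/directv_sumP => i _; apply/eqP; rewrite -subv0.
apply/subvP=> v /memv_capP[Di Dv]; rewrite memv0 -(p_id _ _ Di).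
rewrite -memv_ker; apply: (subvP _ v Dv); apply/subv_sumP=> j ij.
by apply/subvP=> w Dw; rewrite memv_ker (p_0 _ _ ij).
Qed.

(** Phrased through subspaces because the spanning families are predicates rather than lists. An
    equality of linear maps f and g is then a membership in [lker (f - g)]. *)
Definition spans V (P : V -> Prop) : Prop :=
  forall A : {vspace V}, (forall v, P v -> v \in A) -> forall v, v \in A.

Lemma spans_ext V U (P : V -> Prop) (f g : 'Hom(V, U)) :
  spans P -> (forall v, P v -> f v = g v) -> f = g.
Proof.
move=> spP fg; apply/lfunP=> v; apply/eqP; rewrite -memv_lker_sub.
by apply: spP => w Pw; rewrite memv_lker_sub fg.
Qed.

Lemma linear_ext V U (P : V -> Prop) (f g : V -> U) :
  linear f -> linear g -> spans P -> (forall v, P v -> f v = g v) -> f =1 g.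
Proof.
move=> fl gl spP fg v.
have -> : f v = linfun f v by rewrite linfunE.
have -> : g v = linfun g v by rewrite linfunE.
congr (fun_of_lfun _ v); apply: (spans_ext spP) => w Pw.
by rewrite (linfunE _ fl) (linfunE _ gl) fg.
Qed.

HB.instance Definition _ V W (v : V) :=
  GRing.isLinear.Build k W (tensor V W) _ (@tpure k V W v) (tpure_linr v).

(** With the arguments swapped, the map in the first variable is a partial application, which can
    carry a linear structure. *)
Definition tpure_left V W (w : W) (v : V) : tensor V W := tpure v w.

HB.instance Definition _ V W (w : W) :=
  GRing.isLinear.Build k V (tensor V W) _ (@tpure_left V W w) (tpure_linl w).

Lemma tpureZl V W a (v : V) (w : W) : tpure (a *: v) w = a *: tpure v w.
Proof. exact: (linearZ_LR (tpure_left w)). Qed.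

Lemma tpureZr V W a (v : V) (w : W) : tpure v (a *: w) = a *: tpure v w.
Proof. exact: linearZ_LR. Qed.

Lemma tpure0l V W (w : W) : tpure (0 : V) w = 0.
Proof. exact: (linear0 (tpure_left w)). Qed.

Lemma tpure0r V W (v : V) : tpure v (0 : W) = 0.
Proof. exact: linear0. Qed.

Lemma tpure_suml V W (I : finType) (P : pred I) (F : I -> V) (w : W) :
  tpure (\sum_(i | P i) F i) w = \sum_(i | P i) tpure (F i) w.
Proof. exact: (linear_sum (tpure_left w)). Qed.

Lemma tpure_sumr V W (I : finType) (P : pred I) (F : I -> W) (v : V) :
  tpure v (\sum_(i | P i) F i) = \sum_(i | P i) tpure v (F i).
Proof. exact: linear_sum. Qed.

Lemma spans_tpure V W (P : V -> Prop) (Q : W -> Prop) : spans P -> spans Q ->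
  spans (fun t : tensor V W => exists v w, [/\ P v, Q w & t = tpure v w]).
Proof.
move=> spP spQ A PQA t.
have PA v w : P v -> tpure v w \in A.
  move=> Pv; suff: w \in (linfun (tpure v) @^-1: A)%VS.
    by rewrite -memv_preim lfunE.
  by apply: spQ => {}w Qw; rewrite -memv_preim lfunE; apply: PQA; exists v, w.
have allA v w : tpure v w \in A.
  suff: v \in (linfun (tpure_left w) @^-1: A)%VS by rewrite -memv_preim lfunE.
  by apply: spP => {}v Pv; rewrite -memv_preim lfunE; apply: PA.
rewrite [t]matrix_sum_delta; apply: memv_suml => i _; apply: memv_suml => j _.
apply: memvZ; suff -> : delta_mx i j = tpure (vbasis {:V})`_i (vbasis {:W})`_j.
  exact: allA.
apply/matrixP=> i' j'; rewrite !mxE !coord_free ?(basis_free (vbasisP _)) //.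
by rewrite -natrM mulnb [i' == i]eq_sym [j' == j]eq_sym.
Qed.

Lemma tensor_ext V W U (P : V -> Prop) (Q : W -> Prop)
    (f g : 'Hom(tensor V W, U)) :
  spans P -> spans Q ->
  (forall v w, P v -> Q w -> f (tpure v w) = g (tpure v w)) -> f = g.
Proof.
move=> spP spQ fg; apply: (spans_ext (spans_tpure spP spQ)).
by move=> t [v [w [Pv Qw ->]]]; apply: fg.
Qed.

Lemma tmapE V V' W W' (f : 'Hom(V, V')) (g : 'Hom(W, W')) v w :
  tmap f g (tpure v w) = tpure (f v) (g w).
Proof.
rewrite tlift_pure // => [w0|v0] a x y; rewrite linearP ?tpure_linr //=.
exact: tpure_linl.
Qed.

Lemma memv_tspace V W (A : {vspace V}) (B : {vspace W}) v w :
  v \in A -> w \in B -> tpure v w \in tspace A B.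
Proof.
move=> Av Bw; rewrite (coord_vbasis Av) (coord_vbasis Bw) tpure_suml.
apply: memv_suml => i _; rewrite tpure_sumr; apply: memv_suml => j _.
rewrite tpureZl tpureZr !memvZ //; apply: memv_span.
apply/allpairsP; exists ((vbasis A)`_i, (vbasis B)`_j).
by split=> //=; apply: mem_nth; rewrite size_tuple.
Qed.

Lemma tspace_sub V W (A : {vspace V}) (B : {vspace W}) (C : {vspace tensor V W}) :
  (forall v w, v \in A -> w \in B -> tpure v w \in C) -> (tspace A B <= C)%VS.
Proof.
move=> ABC; apply/span_subvP=> t /allpairsP[[v w] /= [Av Bw ->]].
by apply: ABC; apply: vbasis_mem.
Qed.

End LinearAlgebra.

(** * The tensor category of Yetter-Drinfeld modules *)

Section YetterDrinfeldTheory.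
Variables (k : fieldType) (gT : finGroupType) (omega : gT -> gT -> gT -> k).
Hypothesis omega_cocycle : normalized_cocycle omega.
Local Notation gmod := (gmod k gT).
Local Notation isYD := (isYD omega).
Local Notation "V '*t' W" := (ydtens omega V W) (at level 40).
Implicit Types V W U : gmod.

Definition homog V (v : V) : Prop := exists d, v \in gdeg V d.

Lemma spans_homog V : isYD V -> spans (@homog V).
Proof.
move=> ydV A VA v; have: v \in (\sum_d gdeg V d)%VS.
  by rewrite (yd_full ydV) memvf.
apply/subvP/subv_sumP => d _; apply/subvP=> w Vw.
by apply: VA; exists d.
Qed.

Lemma gact_memv V h d v : isYD V -> v \in gdeg V d ->
  gact V h v \in gdeg V (h * d * h^-1)%g.
Proof. by move=> ydV Vd; apply: (subvP (yd_act_deg ydV h d)); apply: memv_img. Qed.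

Lemma mor_memv V W (f : 'Hom(V, W)) d v : isYDmor f -> v \in gdeg V d ->
  f v \in gdeg W d.
Proof. by move=> morf Vd; apply: (subvP (mor_deg morf d)); apply: memv_img. Qed.

Lemma mor_actE V W (f : 'Hom(V, W)) h v : isYDmor f ->
  f (gact V h v) = gact W h (f v).
Proof. by move=> morf; rewrite -!comp_lfunE (mor_act morf). Qed.

(** The graded counterpart of [spans]: each degree is generated separately, so that preservation of
    degrees can also be tested on generators. It does not itself ask that [P d] lie in degree d. *)
Definition generates V (P : gT -> V -> Prop) : Prop :=
  forall d (A : {vspace V}), (forall v, P d v -> v \in A) -> (gdeg V d <= A)%VS.

Lemma generates_homog V : generates (fun d v => v \in gdeg V d).
Proof. by move=> d A dA; apply/subvP. Qed.

Lemma spans_generates V (P : gT -> V -> Prop) : isYD V -> generates P ->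
  spans (fun v => exists d, P d v).
Proof.
move=> ydV genP A PA; apply: (spans_homog ydV) => v [d]; apply/subvP.
by apply: genP => w Pw; apply: PA; exists d.
Qed.

Lemma isYDmor_generates V W (f : 'Hom(V, W)) (P : gT -> V -> Prop) :
    isYD V -> generates P ->
    (forall d v, P d v -> f v \in gdeg W d) ->
    (forall h d v, P d v -> f (gact V h v) = gact W h (f v)) ->
  isYDmor f.
Proof.
move=> ydV genP degf actf; split=> [d | h].
  by rewrite limg_sub_preim; apply: genP => v Pv; rewrite -memv_preim degf.
apply: (spans_ext (spans_generates ydV genP)) => v [d Pv].
by rewrite !comp_lfunE (actf _ d).
Qed.

Lemma isYDmor_id V : isYDmor (\1%VF : 'End(V)).
Proof.
by split=> [d | h]; rewrite ?lim1g ?comp_lfun1l ?comp_lfun1r.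
Qed.

Lemma isYDmor_comp U V W (g : 'Hom(V, W)) (f : 'Hom(U, V)) :
  isYDmor g -> isYDmor f -> isYDmor (g \o f)%VF.
Proof.
move=> morg morf; split=> [d | h].
  by rewrite limg_comp (subv_trans (limgS _ (mor_deg morf d))) ?mor_deg.
by rewrite -comp_lfunA (mor_act morf) !comp_lfunA (mor_act morg).
Qed.

Lemma generates_tens V W (P : gT -> V -> Prop) (Q : gT -> W -> Prop) :
  generates P -> generates Q ->
  generates (V := V *t W) (fun d t => exists a b v w,
    [/\ (a * b)%g = d, P a v, Q b w & t = tpure v w]).
Proof.
move=> genP genQ d A PQA; apply/subv_sumP=> -[a b] /= /eqP abd.
apply: tspace_sub => v w Va Wb.
suff /subvP/(_ v Va) : (gdeg V a <= linfun (tpure_left w) @^-1: A)%VS.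
  by rewrite -memv_preim lfunE.
apply: genP => {Va}v Pv; rewrite -memv_preim lfunE.
suff /subvP/(_ w Wb) : (gdeg W b <= linfun (tpure v) @^-1: A)%VS.
  by rewrite -memv_preim lfunE.
apply: genQ => {Wb}w Qw; rewrite -memv_preim lfunE.
by apply: PQA; exists a, b, v, w.
Qed.

Lemma generates_pure V W : generates (V := V *t W) (fun d t => exists a b v w,
  [/\ (a * b)%g = d, v \in gdeg V a, w \in gdeg W b & t = tpure v w]).
Proof. exact: (generates_tens (@generates_homog V) (@generates_homog W)). Qed.

Lemma ydtens_memv V W a b v w : v \in gdeg V a -> w \in gdeg W b ->
  tpure v w \in gdeg (V *t W) (a * b)%g.
Proof.
move=> Va Wb; have := memv_tspace Va Wb; apply/subvP.
exact: (sumv_sup (a, b)).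
Qed.

Lemma ydtens_isYD V W : isYD V -> isYD W -> isYD (V *t W).
Proof.
move=> ydV ydW; have spVW : spans (fun t : V *t W => exists a b v w,
    [/\ v \in gdeg V a, w \in gdeg W b & t = tpure v w]).
  move=> A PA; apply: (spans_tpure (spans_homog ydV) (spans_homog ydW)).
  by move=> _ [v [w [[a Va] [b Wb] ->]]]; apply: PA; exists a, b, v, w.
(* The projections onto the degrees of the tensor product, as [directv_projections] requires. *)
pose p x : 'End(tensor V W) :=
  \sum_a \sum_(b | (a * b)%g == x) tmap (gproj V a) (gproj W b).
have pE x a b v w : v \in gdeg V a -> w \in gdeg W b ->
    p x (tpure v w) = if (a * b)%g == x then tpure v w else 0.
  move=> Va Wb; rewrite sum_lfunE (bigD1 a) //= [X in _ + X]big1 ?addr0 => [|a' na].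
    rewrite sum_lfunE; case: eqP => [<-|nx].
      rewrite (bigD1 b) //= [X in _ + X]big1 ?addr0 => [|b' /andP[_ nb]].
        by rewrite tmapE (gproj_hom _ ydV Va) (gproj_hom _ ydW Wb) !eqxx.
      by rewrite tmapE (gproj_hom _ ydW Wb) (negPf nb) tpure0r.
    apply: big1 => b' /eqP abx; rewrite tmapE (gproj_hom _ ydW Wb).
    by case: eqP => [eb|]; rewrite ?tpure0r //; case: nx; rewrite -eb.
  rewrite sum_lfunE; apply: big1 => b' _.
  by rewrite tmapE (gproj_hom _ ydV Va) (negPf na) tpure0l.
split.
- apply: (directv_projections (p := p)) => [d t | d e de t].
    have /subvP dP : (gdeg (V *t W) d <= lker (p d - \1%VF))%VS.
      apply: generates_pure => _ [a [b [v [w [<- Va Wb ->]]]]].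
      by rewrite memv_lker_sub (pE _ _ _ _ _ Va Wb) eqxx id_lfunE.
    by move=> /dP; rewrite memv_lker_sub id_lfunE => /eqP.
  have /subvP dP : (gdeg (V *t W) d <= lker (p e))%VS.
    apply: generates_pure => _ [a [b [v [w [abd Va Wb ->]]]]].
    by rewrite memv_ker (pE _ _ _ _ _ Va Wb) abd (negPf de).
  by move=> /dP; rewrite memv_ker => /eqP.
- apply/eqP; rewrite eqEsubv subvf; apply/subvP=> t _.
  apply: spVW => {}t.
  case=> a [b [v [w [Va Wb ->]]]].
  exact: (subvP (sumv_sup (a * b)%g _ (subvv _))) (ydtens_memv Va Wb).
- apply: (spans_ext spVW) => _ [a [b [v [w [Va Wb ->]]]]].
  rewrite (ydtens_actE ydV ydW Va Wb) (yd_act1 ydV) (yd_act1 ydW).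
  by rewrite (gamma_1l omega_cocycle) scale1r !id_lfunE.
- move=> h d; rewrite limg_sub_preim.
  apply: generates_pure => _ [a [b [v [w [<- Va Wb ->]]]]].
  rewrite -memv_preim (ydtens_actE ydV ydW Va Wb) memvZ //.
  have -> : (h * (a * b) * h^-1 = (h * a * h^-1) * (h * b * h^-1))%g.
    by rewrite !mulgA mulgKV.
  by apply: ydtens_memv; apply: gact_memv.
- move=> h x d t dt.
  (* A homogeneous tensor is only a sum of pure ones whose pairs of degrees vary, so the identity is
     stated as an inclusion in a kernel before passing to pure tensors. *)
  suff /subvP/(_ t dt) : (gdeg (V *t W) d <= lker ((gact (V *t W) h \o
      gact (V *t W) x)%VF - tau omega h x d *: gact (V *t W) (h * x)%g))%VS.
    by rewrite memv_lker_sub comp_lfunE scale_lfunE => /eqP.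
  apply: generates_pure => _ [a [b [v [w [<- Va Wb ->]]]]].
  rewrite memv_lker_sub comp_lfunE scale_lfunE !(ydtens_actE ydV ydW Va Wb).
  rewrite lfunZ (ydtens_actE ydV ydW (gact_memv x ydV Va) (gact_memv x ydW Wb)).
  rewrite (yd_actM ydV _ _ Va) (yd_actM ydW _ _ Wb) tpureZl tpureZr !scalerA.
  by rewrite -(gamma_tau omega_cocycle); apply/eqP; congr (_ *: _); ring.
Qed.

Lemma isYDmor_tens V W U (f : 'Hom(V *t W, U)) : isYD V -> isYD W ->
    (forall a b v w, v \in gdeg V a -> w \in gdeg W b ->
       f (tpure v w) \in gdeg U (a * b)%g) ->
    (forall h a b v w, v \in gdeg V a -> w \in gdeg W b ->
       gamma omega h a b *: f (tpure (gact V h v) (gact W h w)) =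
       gact U h (f (tpure v w))) ->
  isYDmor f.
Proof.
move=> ydV ydW degf actf.
apply: (isYDmor_generates (ydtens_isYD ydV ydW) (@generates_pure V W)).
  by move=> _ _ [a [b [v [w [<- Va Wb ->]]]]]; apply: degf.
move=> h _ _ [a [b [v [w [_ Va Wb ->]]]]].
by rewrite (ydtens_actE ydV ydW Va Wb) linearZ -(actf _ _ _ _ _ Va Wb).
Qed.

Lemma isYDmor_tmap V V' W W' (f : 'Hom(V, V')) (g : 'Hom(W, W')) :
    isYD V -> isYD V' -> isYD W -> isYD W' -> isYDmor f -> isYDmor g ->
  isYDmor (ydtmap omega f g).
Proof.
move=> ydV ydV' ydW ydW' morf morg.
apply: isYDmor_tens => // [a b v w Va Wb | h a b v w Va Wb].
  by rewrite tmapE ydtens_memv // mor_memv.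
rewrite !tmapE (ydtens_actE ydV' ydW' (mor_memv morf Va) (mor_memv morg Wb)).
by rewrite !mor_actE.
Qed.

Lemma ydassoc_mor V W U : isYD V -> isYD W -> isYD U ->
  isYDmor (ydassoc omega V W U).
Proof.
move=> ydV ydW ydU.
have ydVW := ydtens_isYD ydV ydW; have ydWU := ydtens_isYD ydW ydU.
apply: (isYDmor_generates (ydtens_isYD ydVW ydU)
    (generates_tens (@generates_pure V W) (@generates_homog U))).
  move=> _ _ [_ [c [_ [u [<- [a [b [v [w [<- Va Wb ->]]]]] Uc ->]]]]].
  rewrite (ydassocE ydV ydW ydU Va Wb Uc) memvZ //.
  by rewrite -mulgA; apply: ydtens_memv => //; apply: ydtens_memv.
move=> h _ _ [_ [c [_ [u [_ [a [b [v [w [_ Va Wb ->]]]]] Uc ->]]]]].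
have Wu := ydtens_memv Wb Uc; have Vw := ydtens_memv Va Wb.
rewrite (ydtens_actE ydVW ydU Vw Uc) (ydtens_actE ydV ydW Va Wb).
rewrite tpureZl !lfunZ (ydassocE ydV ydW ydU Va Wb Uc) lfunZ.
rewrite (ydtens_actE ydV ydWU Va Wu) (ydtens_actE ydW ydU Wb Uc).
have Va' := gact_memv h ydV Va; have Wb' := gact_memv h ydW Wb.
have Uc' := gact_memv h ydU Uc.
rewrite (ydassocE ydV ydW ydU Va' Wb' Uc') tpureZr !scalerA; congr (_ *: _).
have w0 := cocycle_neq0 omega_cocycle;
apply: (mul_ratio_inj _ (esym (gamma_assoc omega_cocycle h a b c))).
  by rewrite !mulf_neq0 ?invr_neq0 ?w0.
by field; rewrite !w0.
Qed.

Lemma ydbraid_mor V W : isYD V -> isYD W -> isYDmor (ydbraid omega V W).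
Proof.
move=> ydV ydW.
apply: isYDmor_tens => // [a b v w Va Wb | h a b v w Va Wb].
  rewrite (ydbraidE _ ydV Va) // -(mulgKV a (a * b)%g).
  by apply: ydtens_memv => //; apply: gact_memv.
rewrite (ydbraidE _ ydV (gact_memv h ydV Va)) (ydbraidE _ ydV Va).
rewrite (ydtens_actE ydW ydV (gact_memv a ydW Wb) Va).
rewrite !(yd_actM ydW _ _ Wb) !tpureZl !scalerA mulgKV.
by rewrite (gamma_tau_braid omega_cocycle).
Qed.

(** Reduces every check on the unit object to degree 1, where [tau] and [gamma] are trivial. *)
Lemma ydunit_deg_eq d (a : k^o) : a \in gdeg (ydunit k gT) d -> d = 1%g \/ a = 0.
Proof.
by rewrite /=; case: eqP => [->|_]; [left | rewrite memv0 => /eqP->; right].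
Qed.

Lemma ydunit_isYD : isYD (ydunit k gT).
Proof.
split=> [|||h d|h x d v /ydunit_deg_eq Dv].
- apply: (directv_projections
    (p := fun d : gT => if d == 1%g then \1%VF else 0%VF : 'End(k^o))).
    by move=> d v /ydunit_deg_eq[->|->]; rewrite ?lfun0 // eqxx id_lfunE.
  move=> d e de v /ydunit_deg_eq[d1|->]; last by rewrite lfun0.
  by rewrite eq_sym -d1 (negPf de) zero_lfunE.
- by apply/eqP; rewrite eqEsubv subvf (sumv_sup 1%g) //= eqxx.
- by [].
- rewrite /= lim1g (_ : (h * d * h^-1 == 1)%g = (d == 1%g)) //.
  by rewrite -eq_mulgV1 -{2}[h]mulg1 (inj_eq (mulgI h)).
- rewrite !id_lfunE; case: Dv => ->; last by rewrite scaler0.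
  by rewrite (tau_1r omega_cocycle) scale1r.
Qed.

Lemma ydunit_memv (a : k^o) : a \in gdeg (ydunit k gT) 1%g.
Proof. by rewrite /= eqxx memvf. Qed.

Lemma ydunit_spans1 : spans (fun a : k^o => a = 1).
Proof. by move=> A A1 a; rewrite -[a]mulr1 -[a * 1]/(a *: (1 : k^o)) memvZ ?A1. Qed.

Lemma ydlunitE V (a : k^o) v : ydlunit omega V (tpure a v) = a *: v.
Proof.
rewrite tlift_pure // => [v0 c x y | a0 c x y].
  by rewrite scalerDl scalerA.
by rewrite scalerDr !scalerA mulrC.
Qed.

Lemma ydrunitE V (a : k^o) v : ydrunit omega V (tpure v a) = a *: v.
Proof.
rewrite tlift_pure // => [a0 c x y | v0 c x y].
  by rewrite scalerDr !scalerA mulrC.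
by rewrite scalerDl scalerA.
Qed.

Lemma ydlunit_mor V : isYD V -> isYDmor (ydlunit omega V).
Proof.
move=> ydV; have yd1 := ydunit_isYD.
apply: isYDmor_tens => //
  [d b a v /ydunit_deg_eq Da Vb | h d b a v /ydunit_deg_eq Da Vb].
  rewrite ydlunitE; case: Da => [->|->]; last by rewrite scale0r mem0v.
  by rewrite mul1g memvZ.
rewrite !ydlunitE lfunZ id_lfunE.
case: Da => [->|->]; last by rewrite !scale0r scaler0.
by rewrite (gamma_1m omega_cocycle) scale1r.
Qed.

Lemma ydrunit_mor V : isYD V -> isYDmor (ydrunit omega V).
Proof.
move=> ydV; have yd1 := ydunit_isYD.
apply: isYDmor_tens => //
  [b d v a Vb /ydunit_deg_eq Da | h b d v a Vb /ydunit_deg_eq Da].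
  rewrite ydrunitE; case: Da => [->|->]; last by rewrite scale0r mem0v.
  by rewrite mulg1 memvZ.
rewrite !ydrunitE lfunZ id_lfunE.
case: Da => [->|->]; last by rewrite !scale0r scaler0.
by rewrite (gamma_1r omega_cocycle) scale1r.
Qed.

Lemma ydtwist_mor V : isYD V -> isYDmor (ydtwist V).
Proof.
move=> ydV.
apply: (isYDmor_generates ydV (@generates_homog V)).
  move=> d v Vd; rewrite (ydtwistE ydV Vd) -{2}[d](mulgK d).
  exact: gact_memv.
move=> h d v Vd; rewrite (ydtwistE ydV Vd) (ydtwistE ydV (gact_memv h ydV Vd)).
by rewrite !(yd_actM ydV _ _ Vd) (tau_twist omega_cocycle) mulgKV.
Qed.

End YetterDrinfeldTheory.

(** * Induction *)

Section InductionTheory.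
Variables (k : fieldType) (gT : finGroupType) (H : {group gT}).
Variable omega : gT -> gT -> gT -> k.
Hypothesis omega_cocycle : normalized_cocycle omega.
Local Notation hT := (subg_of H).
Local Notation omH := (res_cocycle H omega).
Local Notation isYDH := (isYD omH).
Local Notation isYDG := (isYD omega).
Local Notation "V '*H' W" := (ydtens omH V W) (at level 40).
Local Notation "V '*G' W" := (ydtens omega V W) (at level 40).
Local Notation I := (ind H omega).
Local Notation icl := (icl omega).
Implicit Types V W X Y Z : gmod k hT.
Implicit Types (g x y : gT) (h d e f : hT).

Lemma res_cocycle_normalized : normalized_cocycle omH.
Proof.
case: omega_cocycle => w0 wE w1l w1m w1r.
by split=> *; [exact: w0 | exact: wE | exact: w1l | exact: w1m | exact: w1r].
Qed.

Lemma tau_res h h' d : tau omH h h' d = tau omega (sgval h) (sgval h') (sgval d).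
Proof. by []. Qed.

Lemma gamma_res h d e :
  gamma omH h d e = gamma omega (sgval h) (sgval d) (sgval e).
Proof. by []. Qed.

Lemma eq_lcosetP g x :
  reflect (exists h : hT, x = (g * sgval h)%g) (g *: H == x *: H)%g.
Proof.
apply: (iffP eqP) => [gx | [h ->]]; last by rewrite lcosetM (lcoset_id (subgP h)).
have /subgK Hgx : (g^-1 * x)%g \in H by rewrite -mem_lcoset gx lcoset_refl.
by exists (subg H (g^-1 * x)%g); rewrite Hgx mulKVg.
Qed.

(** * The universal property of I(V) and its Yetter-Drinfeld structure *)

HB.instance Definition _ (V : gmod k hT) (g : gT) :=
  GRing.isLinear.Build k V {ffun gT -> V} _ (@gtens k gT V g) (gtens_lin g).

Lemma icl_lin V g : linear (icl (V := V) g).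
Proof. by move=> a v w; rewrite /Defs.icl !linearP. Qed.

HB.instance Definition _ (V : gmod k hT) (g : gT) :=
  GRing.isLinear.Build k V (I V) _ (@Defs.icl k gT H omega V g) (@icl_lin V g).

Lemma iclZ V g a (v : V) : icl g (a *: v) = a *: icl g v.
Proof. exact: linearZ_LR. Qed.

(** The universal property of the quotient. Since [ind_rel] is a sum of images of graded pieces,
    compatibility has to be checked for homogeneous v only. *)
Lemma ind_liftE V (U : vectType k) (F : gT -> V -> U) :
    (forall g, linear (F g)) ->
    (forall g h d v, v \in gdeg V d -> F (g * sgval h)%g v =
      (tau omega g (sgval h) (sgval d))^-1 *: F g (gact V h v)) ->
  forall g v, ind_lift omega F (icl g v) = F g v.
Proof.
move=> Flin Frel.
have PhiL : linear (fun phi : {ffun gT -> V} => \sum_g F g (phi g)).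
  by apply: linear_sumf => g a phi psi; rewrite !ffunE Flin.
have PhiE g v : linfun (fun phi : {ffun gT -> V} => \sum_g F g (phi g))
    (gtens g v) = F g v.
  rewrite (linfunE _ PhiL) (bigD1 g) //= ffunE eqxx big1 ?addr0 // => x nx.
  by rewrite ffunE (negPf nx) linear_at0.
move=> g v; rewrite /ind_lift vquot_liftE //.
do 3! [apply/subv_sumP => ? _].
apply/subvP=> _ /memv_imgP[w Ww ->]; rewrite memv_ker [linfun _ w]linfunE; last first.
  apply: linear_subf; first exact: gtens_lin.
  by apply: linear_scalef => a v1 v2; rewrite linearP gtens_lin.
by rewrite linearB linearZ /= !PhiE subr_eq0; apply/eqP; apply: Frel.
Qed.

Lemma spans_icl V (P : V -> Prop) : spans P ->
  spans (fun p : I V => exists g v, P v /\ p = icl g v).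
Proof.
move=> spP A PA p; rewrite -[p]vquot_pi_surj.
set phi := vsval p.
have -> : phi = \sum_g gtens g (phi g).
  apply/ffunP=> g; rewrite sum_ffunE (bigD1 g) //= ffunE eqxx big1 ?addr0 //.
  by move=> x ngx; rewrite ffunE eq_sym (negPf ngx).
rewrite linear_sum; apply: memv_suml => g _ /=.
suff : phi g \in (linfun (icl g) @^-1: A)%VS by rewrite -memv_preim lfunE.
by apply: spP => v Pv; rewrite -memv_preim lfunE; apply: PA; exists g, v.
Qed.

Lemma ind_ext V (U : vectType k) (F F' : 'Hom(I V, U)) : isYDH V ->
  (forall g d v, v \in gdeg V d -> F (icl g v) = F' (icl g v)) -> F = F'.
Proof.
move=> ydV FF'; apply: (spans_ext (spans_icl (spans_homog ydV))).
by move=> _ [g [v [[d Vd] ->]]]; apply: FF' Vd.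
Qed.

Lemma icl_memv V g d (v : V) : v \in gdeg V d ->
  icl g v \in gdeg (I V) (g * sgval d * g^-1)%g.
Proof.
move=> Vd; apply: (subvP (sumv_sup g _ (sumv_sup d _ (subvv _)))) => //.
by apply/memv_imgP; exists v; rewrite ?lfunE.
Qed.

Lemma generates_icl V (P : hT -> V -> Prop) : generates P ->
  generates (V := I V) (fun x p => exists g d v,
    [/\ (g * sgval d * g^-1)%g = x, P d v & p = icl g v]).
Proof.
move=> genP x A PA; apply/subv_sumP => g _; apply/subv_sumP => d /eqP gdx.
rewrite limg_sub_preim; apply: genP => v Pv; rewrite -memv_preim lfunE.
by apply: PA; exists g, d, v.
Qed.

Lemma generates_icl_homog V : generates (V := I V) (fun x p => exists g d v,
  [/\ (g * sgval d * g^-1)%g = x, v \in gdeg V d & p = icl g v]).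
Proof. exact: (generates_icl (@generates_homog _ _ V)). Qed.

(** The formula for x acting on (g h) (x) v agrees with the one on g (x) h . v by [tau_cocycle] for
    the letters x, g, h. *)
Lemma ind_act_icl V : isYDH V -> forall x g d (v : V), v \in gdeg V d ->
  gact (I V) x (icl g v) = tau omega x g (sgval d) *: icl (x * g)%g v.
Proof.
move=> ydV x.
pose F g v := \sum_(d : hT) tau omega x g (sgval d) *: icl (x * g)%g (gproj V d v).
have FE g d v : v \in gdeg V d ->
    F g v = tau omega x g (sgval d) *: icl (x * g)%g v.
  move=> Vd; rewrite /F (bigD1 d) //= (gproj_hom _ ydV Vd) eqxx big1 ?addr0 //.
  by move=> e ned; rewrite (gproj_hom _ ydV Vd) (negPf ned) linear0 scaler0.
move=> g d v Vd; rewrite -FE //; apply: (ind_liftE (F := F)) => {g d v Vd} [g|g h d v Vd].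
  apply: linear_sumf => d; apply: linear_scalef => a v w.
  by rewrite !linearP.
rewrite (FE _ _ _ Vd) (FE _ _ _ (gact_memv h ydV Vd)) mulgA.
rewrite (icl_relation _ _ _ Vd) !scalerA; congr (_ *: _).
apply: (mul_ratio_inj _ (tau_cocycle omega_cocycle x g (sgval h) (sgval d))).
  by rewrite mulf_neq0 ?tau_neq0.
by field; rewrite !tau_neq0.
Qed.

Lemma ind_isYD V : isYDH V -> isYDG (I V).
Proof.
move=> ydV; have iactE := ind_act_icl ydV.
have spV : spans (fun p : I V => exists g d v, v \in gdeg V d /\ p = icl g v).
  move=> A PA; apply: (spans_icl (spans_homog ydV)) => _ [g [v [[d Vd] ->]]].
  by apply: PA; exists g, d, v.
(* The projection of I(V) onto degree x, on generators. It respects the relations because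
   conjugating d by g h equals conjugating h d h^-1 by g. *)
pose F x g v := \sum_(d : hT | (g * sgval d * g^-1)%g == x) icl g (gproj V d v).
have FE x g d v : v \in gdeg V d ->
    F x g v = if (g * sgval d * g^-1)%g == x then icl g v else 0.
  move=> Vd; rewrite /F; case: ifPn => [gdx | ngdx].
    rewrite (bigD1 d) //= (gproj_hom _ ydV Vd) eqxx big1 ?addr0 //.
    by move=> e /andP[_ ned]; rewrite (gproj_hom _ ydV Vd) (negPf ned) linear0.
  apply: big1 => e gex; rewrite (gproj_hom _ ydV Vd).
  by case: eqP => [ed|_]; rewrite ?linear0 //; rewrite -ed gex in ngdx.
pose p x : 'End(I V) := ind_lift omega (F x).
have pE x g d v : v \in gdeg V d ->
    p x (icl g v) = if (g * sgval d * g^-1)%g == x then icl g v else 0.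
  move=> Vd; rewrite -FE //; apply: ind_liftE => {g d v Vd} [g a v w|g h d v Vd].
    rewrite scaler_sumr -big_split; apply: eq_bigr => d _.
    by rewrite !linearP.
  rewrite (FE _ _ _ _ Vd) (FE _ _ _ _ (gact_memv h ydV Vd)) (icl_relation _ _ _ Vd).
  rewrite /= invMg !mulgA; case: ifP => _ //; by rewrite scaler0.
split.
- apply: (directv_projections (p := p)) => [x q | x y xy q].
    suff /subvP/[apply] : (gdeg (I V) x <= lker (p x - \1%VF))%VS.
      by rewrite memv_lker_sub id_lfunE => /eqP.
    apply: generates_icl_homog => _ [g [d [v [<- Vd ->]]]].
    by rewrite memv_lker_sub (pE _ _ _ _ Vd) eqxx id_lfunE.
  suff /subvP/[apply] : (gdeg (I V) x <= lker (p y))%VS.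
    by rewrite memv_ker => /eqP.
  apply: generates_icl_homog => _ [g [d [v [gdx Vd ->]]]].
  by rewrite memv_ker (pE _ _ _ _ Vd) gdx (negPf xy).
- apply/eqP; rewrite eqEsubv subvf; apply/subvP=> q _.
  apply: spV => _ [g [d [v [Vd ->]]]].
  exact: (subvP (sumv_sup (g * sgval d * g^-1)%g _ (subvv _))) (icl_memv g Vd).
- apply: (spans_ext spV) => _ [g [d [v [Vd ->]]]].
  by rewrite (iactE _ _ _ _ Vd) (tau_1l omega_cocycle) scale1r mul1g id_lfunE.
- move=> x y; rewrite limg_sub_preim.
  apply: generates_icl_homog => _ [g [d [v [<- Vd ->]]]].
  rewrite -memv_preim (iactE _ _ _ _ Vd) memvZ //.
  have -> : (x * (g * sgval d * g^-1) * x^-1 = x * g * sgval d * (x * g)^-1)%g.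
    by rewrite invMg !mulgA.
  exact: icl_memv.
move=> x y z q zq.
suff /subvP/(_ q zq) : (gdeg (I V) z <= lker ((gact (I V) x \o gact (I V) y)%VF
    - tau omega x y z *: gact (I V) (x * y)%g))%VS.
  by rewrite memv_lker_sub comp_lfunE scale_lfunE => /eqP.
apply: generates_icl_homog => _ [g [d [v [<- Vd ->]]]].
rewrite memv_lker_sub comp_lfunE scale_lfunE !(iactE _ _ _ _ Vd) lfunZ.
rewrite (iactE _ _ _ _ Vd) !scalerA mulgA (tau_cocycle omega_cocycle).
by rewrite [X in X *: _]mulrC.
Qed.

Lemma isYDmor_ind V (U : gmod k gT) (F : 'Hom(I V, U)) (P : hT -> V -> Prop) :
    isYDH V -> generates P -> (forall d v, P d v -> v \in gdeg V d) ->
    (forall g d v, P d v -> F (icl g v) \in gdeg U (g * sgval d * g^-1)%g) ->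
    (forall x g d v, P d v ->
      tau omega x g (sgval d) *: F (icl (x * g)%g v) = gact U x (F (icl g v))) ->
  isYDmor F.
Proof.
move=> ydV genP homP degF actF.
apply: (isYDmor_generates (ind_isYD ydV) (generates_icl genP)).
  by move=> _ _ [g [d [v [<- Pv ->]]]]; apply: degF.
move=> x _ _ [g [d [v [_ Pv ->]]]].
by rewrite (ind_act_icl ydV _ _ (homP _ _ Pv)) lfunZ (actF _ _ _ _ Pv).
Qed.

Lemma ind_map_icl V W (F : 'Hom(V, W)) : isYDmor F ->
  forall g v, fmap I F (icl g v) = icl g (F v).
Proof.
move=> morF; apply: ind_liftE => [g a v w | g h d v Vd]; first by rewrite !linearP.
by rewrite (icl_relation _ _ _ (mor_memv morF Vd)) mor_actE.
Qed.

Lemma ind_functor : is_functor omH omega I.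
Proof.
split=> [V ydV | V W F ydV ydW morF | V ydV | U V W F F' ydU ydV ydW morF morF'].
- exact: ind_isYD.
- have mapE := ind_map_icl morF.
  apply: (isYDmor_ind ydV (@generates_homog _ _ V)) => // [g d v Vd | x g d v Vd].
    by rewrite mapE icl_memv // mor_memv.
  by rewrite !mapE (ind_act_icl ydW _ _ (mor_memv morF Vd)).
- apply: (ind_ext ydV) => g d v Vd.
  by rewrite (ind_map_icl (isYDmor_id V)) !id_lfunE.
apply: (ind_ext ydU) => g d v Vd.
rewrite (ind_map_icl (isYDmor_comp morF morF')) (comp_lfunE F) (comp_lfunE (fmap I F)).
by rewrite (ind_map_icl morF') (ind_map_icl morF).
Qed.

(** The twist multiplies by g d g^-1, which sends g (x) v to a multiple of (g d) (x) v. Moving d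
    across the tensor sign gives g (x) d . v, with the quotient of the two scalars of [tau_twist] as
    coefficient. *)
Lemma ind_preserves_ribbon : preserves_ribbon omH I.
Proof.
move=> V ydV; apply: (ind_ext ydV) => g d v Vd.
have mor := ydtwist_mor res_cocycle_normalized ydV.
rewrite (ind_map_icl mor) (ydtwistE ydV Vd).
rewrite (ydtwistE (ind_isYD ydV) (icl_memv g Vd)) (ind_act_icl ydV _ _ Vd).
rewrite mulgKV (icl_relation _ _ _ Vd) scalerA (tau_twist omega_cocycle).
by rewrite divff ?scale1r ?tau_neq0.
Qed.

(** * The oplax structure and its braiding *)

Lemma ind_tens_ext V W (U : vectType k) (P : V -> Prop) (Q : W -> Prop)
    (F F' : 'Hom(I (V *H W), U)) : spans P -> spans Q ->
  (forall g v w, P v -> Q w -> 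
    F (icl (V := V *H W) g (tpure v w)) = F' (icl (V := V *H W) g (tpure v w))) ->
  F = F'.
Proof.
move=> spP spQ FF'; apply: (spans_ext (spans_icl (V := V *H W) (spans_tpure spP spQ))).
by move=> _ [g [_ [[v [w [Pv Qw ->]]] ->]]]; apply: FF'.
Qed.

(** The point is compatibility with the relations: replacing g by g h costs [tau] once on the source
    and once on each factor of the target, and [gamma_tau] for g, h balances these. *)
Lemma ind_nu_icl V W : isYDH V -> isYDH W ->
  forall g d e (v : V) (w : W), v \in gdeg V d -> w \in gdeg W e ->
  ind_nu H omega V W (icl (V := V *H W) g (tpure v w)) =
  gamma omega g (sgval d) (sgval e) *: tpure (icl g v) (icl g w).
Proof.
move=> ydV ydW.
pose n g := tlift (fun v w => \sum_(d : hT) \sum_(e : hT)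
  gamma omega g (sgval d) (sgval e) *:
    (tpure (icl g (gproj V d v)) (icl g (gproj W e w)) : tensor (I V) (I W))).
have nE g d e v w : v \in gdeg V d -> w \in gdeg W e ->
    n g (tpure v w) =
    gamma omega g (sgval d) (sgval e) *: tpure (icl g v) (icl g w).
  move=> Vd We; rewrite tlift_pure => [|w0|v0].
  - rewrite (bigD1 d) //= (bigD1 e) //= !(gproj_hom _ ydV Vd) !(gproj_hom _ ydW We).
    rewrite !eqxx !big1 ?addr0 // => [d' /negPf nd | e' /negPf ne].
      apply: big1 => e' _.
      by rewrite (gproj_hom _ ydV Vd) nd linear0 tpure0l scaler0.
    by rewrite (gproj_hom _ ydW We) ne linear0 tpure0r scaler0.
  - do 2!apply: linear_sumf => ?; apply: linear_scalef => a x y.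
    by rewrite !linearP tpure_linl.
  - do 2!apply: linear_sumf => ?; apply: linear_scalef => a x y.
    by rewrite !linearP.
move=> g d e v w Vd We; rewrite -nE //.
apply: (ind_liftE (V := V *H W) (F := fun g t => n g t)) => {g d e v w Vd We}.
  by move=> g a t t'; rewrite linearP.
move=> g h d t dt; set c := (tau _ _ _ _)^-1.
suff /subvP/(_ t dt) : (gdeg (V *H W) d <=
    lker (n (g * sgval h)%g - c *: (n g \o gact (V *H W) h)%VF))%VS.
  by rewrite memv_lker_sub scale_lfunE comp_lfunE => /eqP.
apply: generates_pure => _ [a [b [v [w [abd Va Wb ->]]]]].
rewrite memv_lker_sub scale_lfunE comp_lfunE (nE _ _ _ _ _ Va Wb).
rewrite (ydtens_actE ydV ydW Va Wb) lfunZ.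
rewrite (nE _ _ _ _ _ (gact_memv h ydV Va) (gact_memv h ydW Wb)).
rewrite (icl_relation _ _ _ Va) (icl_relation _ _ _ Wb) tpureZl tpureZr !scalerA.
rewrite /c -abd gamma_res; apply/eqP; congr (_ *: _).
apply: (mul_ratio_inj _
  (gamma_tau omega_cocycle g (sgval h) (sgval a) (sgval b))).
  by rewrite !mulf_neq0 ?invr_neq0 ?(cocycle_neq0 omega_cocycle).
by field; rewrite !tau_neq0.
Qed.

Lemma ind_eps_icl g (a : k^o) : ind_eps H omega (icl (V := ydunit k hT) g a) = a.
Proof.
apply: (ind_liftE (V := ydunit k hT) (F := fun _ a => a : k^o)) => // g' h d v.
case/ydunit_deg_eq=> -> ; rewrite id_lfunE ?scaler0 //.
by rewrite tau_1r // invr1 scale1r.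
Qed.

Let yd1 := ydunit_isYD res_cocycle_normalized.
Let ydtH V W := @ydtens_isYD _ _ _ res_cocycle_normalized V W.

Lemma ind_nu_mor V W : isYDH V -> isYDH W -> isYDmor (ind_nu H omega V W).
Proof.
move=> ydV ydW; have nuE := ind_nu_icl ydV ydW.
apply: (isYDmor_ind (ydtH ydV ydW) (@generates_pure _ _ omH V W)).
- by move=> _ _ [a [b [v [w [<- Va Wb ->]]]]]; apply: ydtens_memv.
- move=> g _ _ [a [b [v [w [<- Va Wb ->]]]]].
  rewrite (nuE _ _ _ _ _ Va Wb) memvZ //.
  have -> : (g * sgval (a * b) * g^-1 =
             (g * sgval a * g^-1) * (g * sgval b * g^-1))%g.
    by rewrite /= !mulgA mulgKV.
  by apply: ydtens_memv; apply: icl_memv.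
move=> x g _ _ [a [b [v [w [<- Va Wb ->]]]]].
rewrite !(nuE _ _ _ _ _ Va Wb) lfunZ.
rewrite (ydtens_actE (ind_isYD ydV) (ind_isYD ydW) (icl_memv g Va) (icl_memv g Wb)).
rewrite (ind_act_icl ydV _ _ Va) (ind_act_icl ydW _ _ Wb) tpureZl tpureZr.
rewrite !scalerA -(gamma_tau omega_cocycle); congr (_ *: _); ring.
Qed.

Lemma ind_eps_mor : isYDmor (ind_eps H omega).
Proof.
apply: (isYDmor_ind yd1 (@generates_homog _ _ _)) => // [g d a | x g d a].
  rewrite ind_eps_icl; case/ydunit_deg_eq=> ->; rewrite ?mem0v //.
  by rewrite mulg1 mulgV ydunit_memv.
rewrite !ind_eps_icl id_lfunE; case/ydunit_deg_eq=> ->; rewrite ?scaler0 //.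
by rewrite tau_1r // scale1r.
Qed.

Lemma ind_oplax_monoidal :
  @is_oplax_monoidal k hT gT omH omega I (ind_nu H omega) (ind_eps H omega).
Proof.
have wH := res_cocycle_normalized.
split.
- exact: ind_functor.
- exact: ind_nu_mor.
- exact: ind_eps_mor.
- move=> V V' W W' F G ydV ydV' ydW ydW' morF morG.
  apply: (ind_tens_ext (spans_homog ydV) (spans_homog ydW)).
  move=> g v w [d Vd] [e We].
  rewrite (comp_lfunE (ydtmap _ _ _)) (comp_lfunE (ind_nu H omega V' W')).
  rewrite (ind_map_icl (isYDmor_tmap wH ydV ydV' ydW ydW' morF morG)).
  rewrite (ind_nu_icl ydV ydW _ Vd We) lfunZ !tmapE.
  rewrite (ind_nu_icl ydV' ydW' _ (mor_memv morF Vd) (mor_memv morG We)).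
  by rewrite (ind_map_icl morF) (ind_map_icl morG).
- move=> X Y Z ydX ydY ydZ.
  have ydXY := ydtH ydX ydY; have ydYZ := ydtH ydY ydZ.
  apply: (ind_tens_ext (V := X *H Y) (spans_tpure (spans_homog ydX) (spans_homog ydY))
    (spans_homog ydZ)) => g _ z [x [y [[a Xa] [b Yb] ->]]] [c Zc].
  rewrite (comp_lfunE (_ \o ydtmap _ _ _)%VF) (comp_lfunE (ydassoc _ _ _ _)).
  rewrite (comp_lfunE (_ \o ind_nu H omega _ _)%VF) (comp_lfunE (ydtmap _ _ _)).
  rewrite (ind_map_icl (ydassoc_mor wH ydX ydY ydZ)).
  rewrite (ydassocE ydX ydY ydZ Xa Yb Zc) iclZ !lfunZ.
  have XYab : (tpure x y : X *H Y) \in gdeg (X *H Y) (a * b)%g by exact: ydtens_memv.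
  have YZbc : (tpure y z : Y *H Z) \in gdeg (Y *H Z) (b * c)%g by exact: ydtens_memv.
  rewrite (ind_nu_icl ydXY ydZ _ XYab Zc) (ind_nu_icl ydX ydYZ _ Xa YZbc) !lfunZ.
  rewrite !tmapE (ind_nu_icl ydX ydY _ Xa Yb) (ind_nu_icl ydY ydZ _ Yb Zc).
  rewrite !id_lfunE tpureZl tpureZr !lfunZ.
  rewrite (ydassocE (ind_isYD ydX) (ind_isYD ydY) (ind_isYD ydZ)
    (icl_memv g Xa) (icl_memv g Yb) (icl_memv g Zc)) !scalerA.
  congr (_ *: _).
  apply: (mul_ratio_inj _
    (esym (gamma_assoc omega_cocycle g (sgval a) (sgval b) (sgval c)))).
    by rewrite !mulf_neq0 ?invr_neq0 ?(cocycle_neq0 omega_cocycle).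
  by rewrite /res_cocycle; field; rewrite !(cocycle_neq0 omega_cocycle).
- move=> X ydX.
  apply: (ind_tens_ext (V := ydunit k hT) (@ydunit_spans1 k) (spans_homog ydX)).
  move=> g _ x -> [d Xd].
  rewrite (ind_map_icl (ydlunit_mor wH ydX)) (comp_lfunE (_ \o ydtmap _ _ _)%VF).
  rewrite (comp_lfunE (ydlunit _ _)) (ind_nu_icl yd1 ydX _ (ydunit_memv _ _) Xd).
  rewrite !lfunZ tmapE !ydlunitE ind_eps_icl id_lfunE.
  by rewrite (gamma_1m omega_cocycle) iclZ !scale1r.
- move=> X ydX.
  apply: (ind_tens_ext (W := ydunit k hT) (spans_homog ydX) (@ydunit_spans1 k)).
  move=> g x _ [d Xd] ->.
  rewrite (ind_map_icl (ydrunit_mor wH ydX)) (comp_lfunE (_ \o ydtmap _ _ _)%VF).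
  rewrite (comp_lfunE (ydrunit _ _)) (ind_nu_icl ydX yd1 _ Xd (ydunit_memv _ _)).
  rewrite !lfunZ tmapE !ydrunitE ind_eps_icl id_lfunE.
  by rewrite (gamma_1r omega_cocycle) iclZ !scale1r.
Qed.

(** The direct computation gives a ratio of two values of [tau], which [gamma_tau_braid] turns into
    a ratio of values of [gamma]. In this form it serves both braiding axioms: the factor of nu
    cancels the denominator, that of mu the numerator. *)
Lemma ind_braided_icl V W : isYDH V -> isYDH W ->
  forall g d e (v : V) (w : W), v \in gdeg V d -> w \in gdeg W e ->
  ydbraid omega (I V) (I W) (tpure (icl g v) (icl g w)) =
  (gamma omega g (sgval (d * e * d^-1)%g) (sgval d) /
   gamma omega g (sgval d) (sgval e)) *:
    tpure (icl g (gact W d w)) (icl g v).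
Proof.
move=> ydV ydW g d e v w Vd We.
rewrite (ydbraidE _ (ind_isYD ydV) (icl_memv g Vd)) (ind_act_icl ydW _ _ We).
rewrite mulgKV (icl_relation _ _ _ We) !tpureZl scalerA; congr (_ *: _).
apply: (mul_ratio_inj _
  (gamma_tau_braid omega_cocycle g (sgval d) (sgval e))).
  by rewrite !mulf_neq0 ?invr_neq0 ?(cocycle_neq0 omega_cocycle).
by field; rewrite ?gamma_neq0 ?tau_neq0.
Qed.

Lemma ind_braided_oplax_monoidal :
  is_braided_oplax_monoidal omH omega I (ind_nu H omega) (ind_eps H omega).
Proof.
split=> [|X Y ydX ydY]; first exact: ind_oplax_monoidal.
apply: (ind_tens_ext (spans_homog ydX) (spans_homog ydY)).
move=> g x y [d Xd] [e Ye].
rewrite (comp_lfunE (ydbraid _ _ _)) (comp_lfunE (ind_nu H omega _ _)).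
rewrite (ind_map_icl (ydbraid_mor res_cocycle_normalized ydX ydY)).
rewrite (ind_nu_icl ydX ydY _ Xd Ye) lfunZ (ind_braided_icl ydX ydY _ Xd Ye).
rewrite (ydbraidE _ ydX Xd) (ind_nu_icl ydY ydX _ (gact_memv d ydY Ye) Xd).
by rewrite scalerA mulrCA divff ?mulr1 ?gamma_neq0.
Qed.

(** The integrand of [ind_mu], isolated so that linearity and the relations can be proved in each of
    its two pairs of arguments separately. *)
Definition ind_mu_gen V W g (v : V) x (w : W) : I (V *H W) :=
  if (g *: H == x *: H)%g then
    let h : hT := subg H (g^-1 * x)%g in
    \sum_(d : hT) \sum_(e : hT)
      ((tau omega g (sgval h) (sgval e))^-1 *
       (gamma omega g (sgval d) (sgval (h * e * h^-1)%g))^-1) *: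
      icl (V := V *H W) g (tpure (gproj V d v) (gact W h (gproj W e w)))
  else 0.

(** * Well-definedness of [ind_mu] *)

Section MuGenerators.
Variables V W : gmod k hT.
Hypotheses (ydV : isYDH V) (ydW : isYDH W).

Lemma ind_mu_gen_hom g h d e (v : V) (w : W) : v \in gdeg V d -> w \in gdeg W e ->
  ind_mu_gen g v (g * sgval h)%g w =
  ((tau omega g (sgval h) (sgval e))^-1 *
   (gamma omega g (sgval d) (sgval (h * e * h^-1)%g))^-1) *:
  icl (V := V *H W) g (tpure v (gact W h w)).
Proof.
move=> Vd We; rewrite /ind_mu_gen ifT; last by apply/eq_lcosetP; exists h.
rewrite mulKg sgvalK (bigD1 d) //= (bigD1 e) //=.
rewrite !(gproj_hom _ ydV Vd) !(gproj_hom _ ydW We) !eqxx.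
rewrite !big1 ?addr0 // => [d' /negPf nd | e' /negPf ne].
  apply: big1 => e' _.
  by rewrite (gproj_hom _ ydV Vd) nd tpure0l linear0 scaler0.
by rewrite (gproj_hom _ ydW We) ne linear0 tpure0r linear0 scaler0.
Qed.

Lemma ind_mu_gen_eq0 g x (v : V) (w : W) : (g *: H != x *: H)%g ->
  ind_mu_gen g v x w = 0.
Proof. by rewrite /ind_mu_gen => /negPf->. Qed.

Lemma ind_mu_gen_linl g x (w : W) : linear (fun v : V => ind_mu_gen g v x w).
Proof.
rewrite /ind_mu_gen; case: eqP => _ a v v'; last by rewrite scaler0 addr0.
move: a v v'; do 2!apply: linear_sumf => ?; apply: linear_scalef => a v v'.
by rewrite linearP tpure_linl linearP.
Qed.

Lemma ind_mu_gen_linr g x (v : V) : linear (ind_mu_gen g v x : W -> _).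
Proof.
rewrite /ind_mu_gen; case: eqP => _ a w w'; last by rewrite scaler0 addr0.
move: a w w'; do 2!apply: linear_sumf => ?; apply: linear_scalef => a w w'.
by rewrite !linearP.
Qed.

(** Off the coset of g both sides vanish. On it x = g l, and the scalars match by [tau_cocycle] for
    g, l, h. The vector v is arbitrary here because the inner lift in [ind_mu] is taken with v
    fixed. *)
Lemma ind_mu_gen_relr g (v : V) x h e (w : W) : w \in gdeg W e ->
  ind_mu_gen g v (x * sgval h)%g w =
  (tau omega x (sgval h) (sgval e))^-1 *: ind_mu_gen g v x (gact W h w).
Proof.
move=> We; have xh : (x *: H == (x * sgval h) *: H)%g by apply/eq_lcosetP; exists h.
case: (boolP (g *: H == x *: H)%g) => [/eq_lcosetP[l ->{x xh}] | gx]; last first.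
  by rewrite !ind_mu_gen_eq0 ?scaler0 // -(eqP xh).
have linL y u := @ind_mu_gen_linl g y u.
apply: (linear_ext (linL _ _) (linear_scalef _ (linL _ _)) (spans_homog ydV)).
move=> {}v [d Vd].
rewrite -[(g * _ * _)%g]mulgA -[(sgval l * sgval h)%g]/(sgval (l * h)%g).
rewrite (ind_mu_gen_hom _ _ Vd We) (ind_mu_gen_hom _ _ Vd (gact_memv h ydW We)).
rewrite (yd_actM ydW _ _ We) tpureZr iclZ !scalerA invMg !mulgA; congr (_ *: _).
apply: (mul_ratio_inj _
  (esym (tau_cocycle omega_cocycle g (sgval l) (sgval h) (sgval e)))).
  by rewrite !mulf_neq0 ?invr_neq0 ?(cocycle_neq0 omega_cocycle).
by rewrite tau_res; field; rewrite ?gamma_neq0 ?tau_neq0.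
Qed.

Lemma ind_mu_gen_lift g (v : V) x (w : W) :
  ind_lift omega (ind_mu_gen g v) (icl x w) = ind_mu_gen g v x w.
Proof.
apply: ind_liftE => [y | y h e u Wu]; first exact: ind_mu_gen_linr.
exact: ind_mu_gen_relr.
Qed.

(** The left side is expressed over g h and the right side over g, so the relation of I(V (x) W) has
    to be applied to the result. This brings in the action of h on a tensor product, hence
    [gamma_tau] next to [tau_cocycle]. *)
Lemma ind_mu_gen_rell g h d (v : V) x (w : W) : v \in gdeg V d ->
  ind_mu_gen (g * sgval h)%g v x w =
  (tau omega g (sgval h) (sgval d))^-1 *: ind_mu_gen g (gact V h v) x w.
Proof.
move=> Vd; have gh : (g *: H == (g * sgval h) *: H)%g by apply/eq_lcosetP; exists h.
case: (boolP ((g * sgval h) *: H == x *: H)%g) => [/eq_lcosetP[l ->{x}] | gx]; last first.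
  by rewrite !ind_mu_gen_eq0 ?scaler0 // (eqP gh).
have linR y u := @ind_mu_gen_linr y ((g * sgval h) * sgval l)%g u.
apply: (linear_ext (linR _ _) (linear_scalef _ (linR _ _)) (spans_homog ydW)).
move=> {}w [e We].
rewrite (ind_mu_gen_hom _ _ Vd We).
rewrite -[(g * _ * _)%g]mulgA -[(sgval h * sgval l)%g]/(sgval (h * l)%g).
rewrite (ind_mu_gen_hom _ _ (gact_memv h ydV Vd) We).
have We' := gact_memv l ydW We.
rewrite (icl_relation (V := V *H W) _ _ _ (ydtens_memv omH Vd We')).
rewrite (ydtens_actE ydV ydW Vd We') iclZ (yd_actM ydW _ _ We) tpureZr iclZ !scalerA.
congr (_ *: _).
apply: (mul_ratio_inj _ (congr2 *%R
  (tau_cocycle omega_cocycle g (sgval h) (sgval l) (sgval e))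
  (esym (gamma_tau omega_cocycle g (sgval h) (sgval d)
           (sgval (l * e * l^-1)%g))))).
  by rewrite !mulf_neq0 ?invr_neq0 ?(cocycle_neq0 omega_cocycle).
rewrite tau_res gamma_res /= invMg !mulgA.
by field; rewrite ?gamma_neq0 ?tau_neq0.
Qed.

(** [ind_mu] is a lift in p of lifts in q. The inner one exists by [ind_mu_gen_relr]. For the outer
    one, linearity and the relations are equalities of maps on I(W), tested on generators, where
    they become [ind_mu_gen_linl] and [ind_mu_gen_rell]. *)
Lemma ind_mu_icl g (v : V) x (w : W) :
  ind_mu H omega V W (tpure (icl g v) (icl x w)) = ind_mu_gen g v x w.
Proof.
pose L (q : I W) := ind_lift omega (fun g (v : V) => ind_lift omega (ind_mu_gen g v) q).
have spW := spans_icl (spans_homog ydW); have spV := spans_icl (spans_homog ydV).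
have LE q y u : L q (icl y u) = ind_lift omega (ind_mu_gen y u) q.
  apply: (ind_liftE (F := fun y (u : V) => ind_lift omega (ind_mu_gen y u) q)).
    move=> {}y a {}u u'.
    pose K u := ind_lift omega (ind_mu_gen (V := V) (W := W) y u).
    suff -> : ind_lift omega (ind_mu_gen y (a *: u + u')) = a *: K u + K u'.
      by rewrite add_lfunE scale_lfunE.
    apply: (spans_ext spW) => _ [z [w' [_ ->]]].
    by rewrite add_lfunE scale_lfunE !ind_mu_gen_lift ind_mu_gen_linl.
  move=> {}y h d {}u Vu; rewrite -scale_lfunE; congr (fun_of_lfun _ q).
  apply: (spans_ext spW) => _ [z [w' [_ ->]]].
  by rewrite scale_lfunE !ind_mu_gen_lift (ind_mu_gen_rell _ _ _ _ Vu).
rewrite -ind_mu_gen_lift -LE -[ind_mu _ _ _ _]/(tlift (fun p q => L q p)).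
rewrite tlift_pure // => [q a p p' | p a q q']; first by rewrite linearP.
rewrite -scale_lfunE -add_lfunE; congr (fun_of_lfun _ p).
apply: (spans_ext spV) => _ [y [u [_ ->]]].
by rewrite add_lfunE scale_lfunE !LE linearP.
Qed.

Lemma ind_mu_icl_eq0 g x (v : V) (w : W) : (g *: H != x *: H)%g ->
  ind_mu H omega V W (tpure (icl g v) (icl x w)) = 0.
Proof. by rewrite ind_mu_icl => /ind_mu_gen_eq0->. Qed.

Lemma ind_mu_icl_same g d e (v : V) (w : W) : v \in gdeg V d -> w \in gdeg W e ->
  ind_mu H omega V W (tpure (icl g v) (icl g w)) =
  (gamma omega g (sgval d) (sgval e))^-1 *: icl (V := V *H W) g (tpure v w).
Proof.
move=> Vd We; rewrite ind_mu_icl -{2}[g]mulg1 -[1%g]/(sgval (1%g : hT)).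
rewrite (ind_mu_gen_hom _ _ Vd We) (tau_1m omega_cocycle) invr1 mul1r.
by rewrite (yd_act1 ydW) id_lfunE mul1g invg1 mulg1.
Qed.

(* A pair of generators lies in different cosets or can be rewritten on one
   representative, which leaves two cases to check for maps on I(V) (x) I(W). *)
Definition icl_pair (x : gT) (t : tensor (I V) (I W)) : Prop :=
  exists g y d e v w, [/\ (g == y) || (g *: H != y *: H)%g,
    (g * sgval d * g^-1 * (y * sgval e * y^-1))%g = x,
    v \in gdeg V d, w \in gdeg W e & t = tpure (icl g v) (icl y w)].

Lemma generates_icl_pair : generates (V := I V *G I W) icl_pair.
Proof.
move=> z A PA.
have gen := generates_tens (omega := omega)
  (@generates_icl_homog V) (@generates_icl_homog W).
apply: gen => _ [a [b [_ [_ [abz [g [d [v [ga Vd ->]]]] [y [e [w [yb We ->]]]] ->]]]]].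
case: (boolP (g *: H == y *: H)%g) => [/eq_lcosetP[h yE] | gy].
  rewrite yE (icl_relation _ _ _ We) tpureZr memvZ //.
  apply: PA; exists g, g, d, (h * e * h^-1)%g, v, (gact W h w).
  rewrite eqxx (gact_memv h ydW We); split=> //.
  by rewrite ga -abz -yb yE /= invMg !mulgA.
apply: PA; exists g, y, d, e, v, w; split=> //; first by rewrite gy orbT.
by rewrite ga yb.
Qed.

End MuGenerators.

(** * The lax structure and its braiding *)

Lemma ind_pair_ext V W (U : vectType k) (F F' : 'Hom(tensor (I V) (I W), U)) :
    isYDH V -> isYDH W ->
    (forall g y d e v w, (g *: H != y *: H)%g -> v \in gdeg V d -> w \in gdeg W e ->
      F (tpure (icl g v) (icl y w)) = F' (tpure (icl g v) (icl y w))) ->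
    (forall g d e v w, v \in gdeg V d -> w \in gdeg W e ->
      F (tpure (icl g v) (icl g w)) = F' (tpure (icl g v) (icl g w))) ->
  F = F'.
Proof.
move=> ydV ydW Fne Feq.
have ydI := ydtens_isYD omega_cocycle (ind_isYD ydV) (ind_isYD ydW).
apply: (spans_ext (spans_generates ydI (generates_icl_pair ydW))).
move=> _ [_ [g [y [d [e [v [w [/orP[/eqP<- | gy] _ Vd We ->]]]]]]]].
  exact: Feq Vd We.
exact: Fne Vd We.
Qed.

Lemma lcoset_actE x g y :
  ((x * g) *: H == (x * y) *: H)%g = (g *: H == y *: H)%g.
Proof. by rewrite !lcosetM (inj_eq (can_inj (lcosetK x))). Qed.

Lemma ind_mu_mor V W : isYDH V -> isYDH W -> isYDmor (ind_mu H omega V W).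
Proof.
move=> ydV ydW; have ydI := ydtens_isYD omega_cocycle (ind_isYD ydV) (ind_isYD ydW).
have muE := ind_mu_icl_same ydV ydW; have mu0 := ind_mu_icl_eq0 ydV ydW.
apply: (isYDmor_generates ydI (generates_icl_pair ydW)) => [z t | x z t].
  case=> g [y [d [e [v [w [/orP[/eqP<- | gy] <- Vd We ->]]]]]]; last first.
    by rewrite mu0 ?mem0v.
  rewrite (muE _ _ _ _ _ Vd We) memvZ //.
  have := icl_memv (V := V *H W) g (ydtens_memv omH Vd We).
  by rewrite /= !mulgA mulgKV.
case=> g [y [d [e [v [w [gy _ Vd We ->]]]]]].
rewrite (ydtens_actE (ind_isYD ydV) (ind_isYD ydW) (icl_memv g Vd) (icl_memv y We)).
rewrite (ind_act_icl ydV _ _ Vd) (ind_act_icl ydW _ _ We) tpureZl tpureZr !lfunZ.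
case/orP: gy => [/eqP<- | gy]; last by rewrite !mu0 ?lcoset_actE // !scaler0 lfun0.
rewrite !(muE _ _ _ _ _ Vd We) lfunZ.
rewrite (ind_act_icl (ydtH ydV ydW) _ _ (ydtens_memv omH Vd We)) !scalerA.
congr (_ *: _).
apply: (mul_ratio_inj _
  (esym (gamma_tau omega_cocycle x g (sgval d) (sgval e)))).
  by rewrite !mulf_neq0 ?invr_neq0 ?(cocycle_neq0 omega_cocycle).
by rewrite /=; field; rewrite !gamma_neq0.
Qed.

(** In degree 1 the scalar [tau] of the relation is 1 and the action is trivial. Hence eta does not
    depend on the representatives, and the action of G merely permutes its terms. *)
Lemma icl_unit_coset g x (a : k^o) : (g *: H = x *: H)%g ->
  icl (V := ydunit k hT) g a = icl (V := ydunit k hT) x a.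
Proof.
move/eqP/eq_lcosetP=> [h ->].
rewrite (icl_relation (V := ydunit k hT) _ _ _ (ydunit_memv _ a)).
by rewrite (tau_1r omega_cocycle) invr1 scale1r id_lfunE.
Qed.

Lemma ind_eta_lcosets (a : k^o) :
  ind_eta H omega a = \sum_(C in lcosets H [set: gT]) icl (V := ydunit k hT) (repr C) a.
Proof.
by rewrite linfunE //; apply: linear_sumf => C; exact: (@icl_lin (ydunit k hT)).
Qed.

Lemma repr_lcosets (C : {set gT}) : C \in lcosets H [set: gT] -> (repr C *: H = C)%g.
Proof.
case/lcosetsP=> g _ ->; apply/eqP; rewrite eq_sym.
have /lcosetP[h Hh ->] := mem_repr g (lcoset_refl H g).
by rewrite lcosetM (lcoset_id Hh).
Qed.

Lemma ind_eta_transversal (X : {set gT}) (a : k^o) :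
  is_transversal X (lcosets H [set: gT]) [set: gT] ->
  ind_eta H omega a = \sum_(g in X) icl (V := ydunit k hT) g a.
Proof.
move=> trX; rewrite ind_eta_lcosets.
have tiP : trivIset (lcosets H [set: gT]) by case/and3P: trX => /and3P[].
rewrite -{1}(pblock_transversal trX) big_imset; last exact: pblock_inj trX.
apply: eq_bigr => g _; apply: icl_unit_coset.
have gH : (g *: H)%g \in lcosets H [set: gT] by apply/lcosetsP; exists g; rewrite ?inE.
by rewrite /= (def_pblock tiP gH (lcoset_refl H g)) repr_lcosets.
Qed.

Lemma ind_eta_mor : isYDmor (ind_eta H omega).
Proof.
split=> [d | x].
  rewrite limg_sub_preim; apply/subvP=> a /ydunit_deg_eq Da.
  rewrite -memv_preim; case: Da => [->|->]; last by rewrite lfun0 mem0v.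
  rewrite ind_eta_lcosets; apply: memv_suml => C _.
  have := icl_memv (V := ydunit k hT) (repr C) (ydunit_memv hT a).
  by rewrite mulg1 mulgV.
apply/lfunP=> a; rewrite (comp_lfunE (ind_eta _ _)) id_lfunE.
rewrite (comp_lfunE (gact _ _)) ind_eta_lcosets.
(* Left translation by x permutes the left cosets of H; it matches the terms of eta with their
   images under x. *)
rewrite lfun_sum (reindex_inj (can_inj (lcosetK x))).
have mem_lc (y : gT) C : C \in lcosets H [set: gT] -> (y *: C)%g \in lcosets H [set: gT].
  by case/lcosetsP=> g _ ->; apply/lcosetsP; exists (y * g)%g; rewrite ?inE ?lcosetM.
apply: eq_big => [C | C xC].
  by apply/idP/idP => [/(mem_lc x^-1%g)|]; rewrite ?lcosetK //; apply: mem_lc.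
have CH : C \in lcosets H [set: gT] by rewrite -(lcosetK x C) mem_lc.
rewrite (ind_act_icl yd1 _ _ (ydunit_memv hT a)) (tau_1r omega_cocycle) scale1r.
by apply: icl_unit_coset; rewrite repr_lcosets // lcosetM repr_lcosets.
Qed.

(** Only the coset of g contributes to eta followed by mu. The surviving term sits at the chosen
    representative of that coset, which need not be g; [icl_unit_coset] then moves it to g. *)
Lemma sum_lcosets1 (U : vectType k) (F : gT -> U) g :
    (forall x, (x *: H != g *: H)%g -> F x = 0) ->
  exists2 x, (x *: H = g *: H)%g & \sum_(C in lcosets H [set: gT]) F (repr C) = F x.
Proof.
move=> F0; have gH : (g *: H)%g \in lcosets H [set: gT].
  by apply/lcosetsP; exists g; rewrite ?inE.
exists (repr (g *: H)%g); first exact: repr_lcosets.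
rewrite (bigD1 _ gH) /= big1 ?addr0 // => C /andP[CH nC].
by rewrite F0 // repr_lcosets.
Qed.

Lemma ind_lax_monoidal :
  @is_lax_monoidal k hT gT omH omega I (ind_mu H omega) (ind_eta H omega).
Proof.
have wH := res_cocycle_normalized.
split.
- exact: ind_functor.
- exact: ind_mu_mor.
- exact: ind_eta_mor.
- move=> V V' W W' F G ydV ydV' ydW ydW' morF morG.
  apply: (ind_pair_ext ydV ydW) => [g y d e v w gy Vd We | g d e v w Vd We];
    rewrite (comp_lfunE (ind_mu H omega V' W')) (comp_lfunE (fmap I (ydtmap _ _ _)));
    rewrite tmapE (ind_map_icl morF) (ind_map_icl morG).
    by rewrite (ind_mu_icl_eq0 ydV ydW) // (ind_mu_icl_eq0 ydV' ydW') // lfun0.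
  rewrite (ind_mu_icl_same ydV ydW _ Vd We) lfunZ.
  rewrite (ind_mu_icl_same ydV' ydW' _ (mor_memv morF Vd) (mor_memv morG We)).
  by rewrite (ind_map_icl (isYDmor_tmap wH ydV ydV' ydW ydW' morF morG)) tmapE.
- move=> X Y Z ydX ydY ydZ.
  have ydXY := ydtH ydX ydY; have ydYZ := ydtH ydY ydZ.
  have ydIXY := ydtens_isYD omega_cocycle (ind_isYD ydX) (ind_isYD ydY).
  apply: (tensor_ext (spans_generates ydIXY (generates_icl_pair ydY))
    (spans_icl (spans_homog ydZ))).
  move=> _ _ [_ [g [y [a [b [u [v [gy _ Xa Yb ->]]]]]]]] [z [w [[c Zc] ->]]].
  rewrite [LHS]comp_lfun3E [RHS]comp_lfun3E.
  rewrite (ydassocE (ind_isYD ydX) (ind_isYD ydY) (ind_isYD ydZ)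
    (icl_memv g Xa) (icl_memv y Yb) (icl_memv z Zc)) !lfunZ !tmapE !id_lfunE.
  (* Both composites vanish unless the three cosets coincide. If the first two differ, the right
     side may still merge the last two over y, but the outer mu then kills the result. *)
  case/orP: gy => [/eqP<-{y} | gy]; last first.
    rewrite (ind_mu_icl_eq0 ydX ydY) // tpure0l !lfun0.
    case: (boolP (y *: H == z *: H)%g) => [/eq_lcosetP[h ->] | yz]; last first.
      by rewrite (ind_mu_icl_eq0 ydY ydZ) // tpure0r lfun0 scaler0.
    rewrite (icl_relation _ _ _ Zc) tpureZr lfunZ.
    rewrite (ind_mu_icl_same ydY ydZ _ Yb (gact_memv h ydZ Zc)) !tpureZr !lfunZ.
    by rewrite (ind_mu_icl_eq0 ydX ydYZ) // !scaler0.
  have XYab : (tpure u v : X *H Y) \in gdeg (X *H Y) (a * b)%g by exact: ydtens_memv.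
  rewrite (ind_mu_icl_same ydX ydY _ Xa Yb) tpureZl !lfunZ.
  case: (boolP (g *: H == z *: H)%g) => [/eq_lcosetP[h zE] | gz]; last first.
    rewrite (ind_mu_icl_eq0 ydXY ydZ) // (ind_mu_icl_eq0 ydY ydZ) //.
    by rewrite tpure0r !lfun0 !scaler0.
  rewrite zE (icl_relation _ _ _ Zc) !tpureZr !lfunZ tpureZr !lfunZ.
  have Zc' := gact_memv h ydZ Zc; set w' := gact Z h w in Zc' *.
  set c' := (h * c * h^-1)%g in Zc'.
  have YZbc : (tpure v w' : Y *H Z) \in gdeg (Y *H Z) (b * c')%g by exact: ydtens_memv.
  rewrite (ind_mu_icl_same ydXY ydZ _ XYab Zc') (ind_mu_icl_same ydY ydZ _ Yb Zc').
  rewrite tpureZr !lfunZ (ind_mu_icl_same ydX ydYZ _ Xa YZbc).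
  rewrite (ind_map_icl (ydassoc_mor wH ydX ydY ydZ)).
  rewrite (ydassocE ydX ydY ydZ Xa Yb Zc') iclZ !scalerA.
  congr (_ *: _).
  (* The associator was evaluated before z was rewritten over g, so its third degree still has to be
     expressed through g and c'. *)
  have -> : (g * sgval h * sgval c * (g * sgval h)^-1 = g * sgval c' * g^-1)%g.
    by rewrite /= invMg !mulgA.
  apply: (mul_ratio_inj _
    (gamma_assoc omega_cocycle g (sgval a) (sgval b) (sgval c'))).
    by rewrite !mulf_neq0 ?invr_neq0 ?(cocycle_neq0 omega_cocycle).
  rewrite /res_cocycle; field.
  by rewrite !(cocycle_neq0 omega_cocycle) !gamma_neq0 ?tau_neq0.
- move=> X ydX.
  apply: (tensor_ext (@ydunit_spans1 k) (spans_icl (spans_homog ydX))).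
  move=> _ _ -> [g [x [[d Xd] ->]]].
  rewrite [LHS]comp_lfun3E.
  rewrite tmapE id_lfunE ind_eta_lcosets tpure_suml lfun_sum ydlunitE scale1r.
  have [y|y yg ->] := sum_lcosets1 (g := g) (F := fun y =>
    ind_mu H omega _ X (tpure (icl (V := ydunit k hT) y 1) (icl g x))).
    exact: (ind_mu_icl_eq0 yd1 ydX).
  rewrite (icl_unit_coset _ yg) (ind_mu_icl_same yd1 ydX _ (ydunit_memv _ _) Xd).
  rewrite (gamma_1m omega_cocycle) invr1 scale1r.
  by rewrite (ind_map_icl (ydlunit_mor wH ydX)) ydlunitE scale1r.
- move=> X ydX.
  apply: (tensor_ext (spans_icl (spans_homog ydX)) (@ydunit_spans1 k)).
  move=> _ _ [g [x [[d Xd] ->]]] ->.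
  rewrite [LHS]comp_lfun3E.
  rewrite tmapE id_lfunE ind_eta_lcosets tpure_sumr lfun_sum ydrunitE scale1r.
  have [y|y yg ->] := sum_lcosets1 (g := g) (F := fun y =>
    ind_mu H omega X _ (tpure (icl g x) (icl (V := ydunit k hT) y 1))).
    by rewrite eq_sym; apply: (ind_mu_icl_eq0 ydX yd1).
  rewrite (icl_unit_coset _ yg) (ind_mu_icl_same ydX yd1 _ Xd (ydunit_memv _ _)).
  rewrite (gamma_1r omega_cocycle) invr1 scale1r.
  by rewrite (ind_map_icl (ydrunit_mor wH ydX)) ydrunitE scale1r.
Qed.

Lemma ind_braided_lax_monoidal :
  is_braided_lax_monoidal omH omega I (ind_mu H omega) (ind_eta H omega).
Proof.
split=> [|X Y ydX ydY]; first exact: ind_lax_monoidal.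
apply: (ind_pair_ext ydX ydY) => [g z d e x y gz Xd Ye | g d e x y Xd Ye];
  rewrite (comp_lfunE (ind_mu H omega Y X)) (comp_lfunE (fmap I (ydbraid _ _ _))).
  rewrite (ind_mu_icl_eq0 ydX ydY) // lfun0.
  rewrite (ydbraidE _ (ind_isYD ydX) (icl_memv g Xd)) (ind_act_icl ydY _ _ Ye).
  rewrite tpureZl lfunZ (ind_mu_icl_eq0 ydY ydX) ?scaler0 //.
  (* The braiding translates the second generator by g d g^-1, which fixes the coset of g. Distinct
     cosets therefore stay distinct, and mu vanishes after the braiding too. *)
  have -> : (g *: H = (g * sgval d * g^-1 * g) *: H)%g.
    by rewrite mulgKV lcosetM (lcoset_id (subgP d)).
  by rewrite lcoset_actE eq_sym.
rewrite (ind_braided_icl ydX ydY _ Xd Ye) (ind_mu_icl_same ydX ydY _ Xd Ye) !lfunZ.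
rewrite (ind_mu_icl_same ydY ydX _ (gact_memv d ydY Ye) Xd).
rewrite (ind_map_icl (ydbraid_mor res_cocycle_normalized ydX ydY)).
rewrite (ydbraidE _ ydX Xd) scalerA; congr (_ *: _).
by rewrite mulrAC divff ?mul1r ?gamma_neq0.
Qed.

Lemma ind_induction_formulas : induction_formulas H omega.
Proof.
split.
- exact: ind_act_icl.
- by move=> V W F _ _; apply: ind_map_icl.
- exact: ind_nu_icl.
- by move=> g; apply: ind_eps_icl.
- by move=> V W ydV ydW; apply: ind_mu_icl_eq0.
- exact: ind_mu_icl_same.
- by move=> X; apply: ind_eta_transversal.
Qed.

End InductionTheory.

Theorem proposition3p10 (k : closedFieldType) (gT : finGroupType)
    (H : {group gT}) (omega : gT -> gT -> gT -> k)
    (omega_cocycle : normalized_cocycle omega) :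
  [/\ induction_formulas H omega,
      is_braided_lax_monoidal (res_cocycle H omega) omega (ind H omega)
        (ind_mu H omega) (ind_eta H omega),
      is_braided_oplax_monoidal (res_cocycle H omega) omega (ind H omega)
        (ind_nu H omega) (ind_eps H omega) &
      preserves_ribbon (res_cocycle H omega) (ind H omega)].
Proof.
split.
- exact: ind_induction_formulas.
- exact: ind_braided_lax_monoidal.
- exact: ind_braided_oplax_monoidal.
- exact: ind_preserves_ribbon.
Qed.
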